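(* Let $d\ge 1$, $\Omega=[-1/2,1/2]^d$, and let $F:\mathbb{R}^d\to\mathbb{C}$ be measurable and $1$-periodic, with Fourier coefficients $\hat F(k)=\int_\Omega F(x)e^{-2i\pi k\cdot x}dx$ ($k\in\mathbb{Z}^d$), such that $F(x)=\sum_{k\in\mathbb{Z}^d}\hat F(k)e^{2i\pi k\cdot x}$ for almost every $x$ and at $x=0$. Let $X_1,X_2,\dots$ be independent uniformly distributed points in $\Omega$ and let $\lambda_1(n),\dots,\lambda_n(n)$ be the eigenvalues of the $n\times n$ matrix $A=(F(X_i-X_j))_{1\le i,j\le n}$. Then almost surely $$\lim_{n\to\infty}\max_{1\le i\le n}\frac{|\lambda_i(n)|}{n}=\max_{k\in\mathbb{Z}^d}|\hat F(k)|.$$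
   Context: $1$-periodic means: if $x,y\in\mathbb{R}^d$ and $x-y\in\mathbb{Z}^d$ then $F(x)=F(y)$. *)

(* Defs.v *)
From HB Require Import structures.
From mathcomp Require Import all_boot all_order all_algebra.
From mathcomp Require Import finmap complex.
From mathcomp Require Import all_classical all_reals all_analysis.
From mathcomp Require Import summability.

Set Implicit Arguments.
Unset Strict Implicit.
Unset Printing Implicit Defensive.

Import Order.TTheory GRing.Theory Num.Theory.
Import numFieldNormedType.Exports.

Local Open Scope classical_set_scope.
Local Open Scope ring_scope.
Local Open Scope complex_scope.

(* R^d is represented by d-tuples because these carry the library's product
   (Borel) sigma-algebra; row vectors have no measurable structure. *)
Notation Rd R d := (d.-tuple (measurableTypeR R)).

Section lebesgue_measure_tuple.
Context {R : realType}.

Let uncons n (x : Rd R n.+1) : measurableTypeR R * Rd R n :=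
  (thead x, [tuple of behead x]).

Let cons_pair n (y : measurableTypeR R * Rd R n) : Rd R n.+1 :=
  [tuple of y.1 :: y.2].

Let cons_pairK n : cancel (@cons_pair n) (@uncons n).
Proof.
by move=> [a v]; rewrite /uncons /cons_pair theadE; congr pair; exact: val_inj.
Qed.

Let measurable_cons_pair n : measurable_fun setT (@cons_pair n).
Proof. exact: measurable_cons. Qed.

Let measurable_uncons n : measurable_fun setT (@uncons n).
Proof.
apply/measurable_fun_pairP; split; first exact: measurable_tnth.
exact: measurable_behead.
Qed.

Section successor.
Variables (n : nat) (mu : {sigma_finite_measure set (Rd R n) -> \bar R}).

Definition lebesgue_cons : set (Rd R n.+1) -> \bar R :=
  pushforward (lebesgue_measure \x mu)%E (@cons_pair n).

Let lebesgue_cons0 : lebesgue_cons set0 = 0%E.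
Proof. by rewrite /lebesgue_cons /pushforward preimage_set0 measure0. Qed.

Let lebesgue_cons_ge0 A : (0 <= lebesgue_cons A)%E.
Proof. exact: (measure_ge0 (lebesgue_measure \x mu)%E). Qed.

Let lebesgue_cons_sigma_additive : semi_sigma_additive lebesgue_cons.
Proof.
pose m : {measure set _ -> \bar R} := (lebesgue_measure \x mu)%E.
have mf (A : set (Rd R n.+1)) : measurable A -> measurable (@cons_pair n @^-1` A).
  by move=> mA; rewrite -[X in measurable X]setTI; exact: measurable_cons_pair.
move=> F mF tF mUF; rewrite /lebesgue_cons /pushforward preimage_bigcup.
apply: (@measure_semi_sigma_additive _ _ _ m).
- by move=> k; exact: mf.
- apply/trivIsetP => i j _ _ ij; rewrite -preimage_setI.
  by move/trivIsetP : tF => /(_ _ _ _ _ ij) ->//; rewrite preimage_set0.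
- by rewrite -preimage_bigcup; exact: mf.
Qed.

HB.instance Definition _ := isMeasure.Build _ _ _ lebesgue_cons
  lebesgue_cons0 lebesgue_cons_ge0 lebesgue_cons_sigma_additive.

Let lebesgue_cons_sigma_finite : sigma_finite setT lebesgue_cons.
Proof.
have /sigma_finiteP[F [TF ndF Foo]] := sigma_finiteT (@lebesgue_measure R).
have /sigma_finiteP[G [TG ndG Goo]] := sigma_finiteT mu.
exists (fun k => @uncons n @^-1` (F k `*` G k)).
  apply/seteqP; split=> // x _.
  have [i _ Fi] : (\bigcup_i F i) (uncons x).1 by rewrite -TF.
  have [j _ Gj] : (\bigcup_i G i) (uncons x).2 by rewrite -TG.
  exists (maxn i j) => //; split.
  - by move: Fi; exact/subsetPset/ndF/leq_maxl.
  - by move: Gj; exact/subsetPset/ndG/leq_maxr.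
move=> k; have [mF Fk] := Foo k; have [mG Gk] := Goo k; split.
  rewrite -[X in measurable X]setTI; apply: measurable_uncons => //.
  exact: measurableX.
rewrite /lebesgue_cons /pushforward -comp_preimage.
rewrite (_ : _ \o _ = id); last by apply/funext => y /=; exact: cons_pairK.
by rewrite preimage_id product_measure1E// lte_mul_pinfty// ge0_fin_numE.
Qed.

HB.instance Definition _ := Measure_isSigmaFinite.Build _ _ _ lebesgue_cons
  lebesgue_cons_sigma_finite.

End successor.

(* Lebesgue measure on R^d: the d-fold product of the Lebesgue measure on R,
   transported along R * R^n -> R^(n+1); R^0 is a single point of mass 1. *)
Fixpoint lebesgue_tuple d : {sigma_finite_measure set (Rd R d) -> \bar R} :=
  match d with
  | 0 => dirac ([tuple] : Rd R 0)
  | n.+1 => lebesgue_cons (lebesgue_tuple n)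
  end.

End lebesgue_measure_tuple.

Section euclidean_space.
Context {R : realType} {d : nat}.
Implicit Types (x y : Rd R d) (k : d.-tuple int).

Definition origin : Rd R d := [tuple (0 : R) | i < d].

Definition vsub x y : Rd R d := [tuple (tnth x i - tnth y i : R) | i < d].

Definition dotZ k x : R := \sum_(i < d) (tnth k i)%:~R * (tnth x i : R).

Definition cube : set (Rd R d) :=
  [set x | forall i : 'I_d, - (2^-1) <= (tnth x i : R) <= 2^-1].

Definition periodic1 (F : Rd R d -> R[i]) : Prop :=
  forall x y, (exists k, forall i, (tnth x i - tnth y i : R) = (tnth k i)%:~R) ->
  F x = F y.

End euclidean_space.

Definition cexpi {R : realType} (t : R) : R[i] := cos t +i* sin t.

Section complex_integration.
Context d (T : measurableType d) (R : realType).
Implicit Types (mu : {measure set T -> \bar R}) (D : set T) (f : T -> R[i]).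

Definition cmeasurable f : Prop :=
  measurable_fun setT (fun x => complex.Re (f x)) /\
  measurable_fun setT (fun x => complex.Im (f x)).

Definition cintegrable mu D f : Prop :=
  mu.-integrable D (fun x => (complex.Re (f x))%:E) /\
  mu.-integrable D (fun x => (complex.Im (f x))%:E).

Definition cintegral mu D f : R[i] :=
  Rintegral mu D (fun x => complex.Re (f x)) +i*
  Rintegral mu D (fun x => complex.Im (f x)).

End complex_integration.

Definition fourier_coef {R : realType} {d : nat} (F : Rd R d -> R[i])
    (k : d.-tuple int) : R[i] :=
  cintegral (lebesgue_tuple d) cube
    (fun x => F x * cexpi (- (2 * pi * dotZ k x))).

(* The sum of a family indexed by an unordered set: limit of the finite partial
   sums along the directed set of finite subsets. R[i]^o is R[i] with the
   topology of its modulus. *)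
Definition has_sum {R : realType} {I : choiceType} (f : I -> R[i]) (s : R[i]) :
    Prop :=
  partial_sum (f : I -> R[i]^o) @ totally --> (s : R[i]^o).

Section random_variables.
Context (d d' : measure_display) (T : measurableType d) (R : realType).
Context (P : probability T R) (E : measurableType d').

Definition mutually_independent (X : nat -> {RV P >-> E}) : Prop :=
  forall (J : {fset nat}) (B : nat -> set E), (forall i, measurable (B i)) ->
  P (\bigcap_(i in [set` J]) (X i @^-1` B i)) =
  (\prod_(i <- J) P (X i @^-1` B i))%E.

End random_variables.

(* The cube has volume 1, so no normalisation is needed. *)
Definition uniform_on_cube {R : realType} {d : nat} {dT : measure_display}
    {T : measurableType dT} {P : probability T R} (X : {RV P >-> Rd R d}) : Prop :=
  forall B, measurable B -> distribution P X B = lebesgue_tuple d (B `&` cube).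

(* The points are numbered from 0. *)
Definition euclidean_matrix {R : realType} {d : nat} (F : Rd R d -> R[i])
    (x : nat -> Rd R d) (n : nat) : 'M[R[i]]_n :=
  \matrix_(i < n, j < n) F (vsub (x i) (x j)).

(* The eigenvalues listed with algebraic multiplicity. *)
Definition eigenvalues_of {R : realType} {n : nat} (A : 'M[R[i]]_n)
    (l : 'I_n -> R[i]) : Prop :=
  char_poly A = \prod_(i < n) ('X - (l i)%:P).

Definition modulus {R : realType} (z : R[i]) : R := ComplexField.Normc.normc z.

(* Main.v *)
Require Import Defs.
From HB Require Import structures.
From mathcomp Require Import all_boot all_order all_algebra.
From mathcomp Require Import finmap complex.
From mathcomp Require Import all_classical all_reals all_analysis.
From mathcomp Require Import summability measurable_realfun.
From mathcomp Require Import ring lra zify.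
Import Order.TTheory GRing.Theory Num.Theory.
Import numFieldNormedType.Exports.
Local Open Scope classical_set_scope.
Local Open Scope ring_scope.
Local Open Scope complex_scope.

Set Implicit Arguments.
Unset Strict Implicit.
Unset Printing Implicit Defensive.

(** The coefficients c k = fourier_coef F k are absolutely summable, because
    their series converges unconditionally at the origin.  The difference of
    two independent uniform points has an absolutely continuous law
    (ae_difference), so almost surely the Fourier series represents every entry:
    A i j is the sum over k of c k * u_k(i) * conj (u_k(j)), where u_k(i) is the
    character of frequency k at the i-th point.  By the strong law of large
    numbers (ae_mean_cexpi_cvg0) the vectors u_k become orthonormal for the
    Hermitian product divided by n.  Thus A / n looks like the diagonal matrix of
    the c k, and it remains to transfer this to the eigenvalues (spectral_limit).
    The coefficients are complex and A need not be normal, so closeness in norm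
    does not suffice.

    Upper bound (eigenvalue_upper).  Up to a small tail only finitely many
    frequencies matter.  The means of an eigenvector against the corresponding
    u_k satisfy an almost diagonal linear system with diagonal entries c k,
    which excludes eigenvalues larger than the maximum of modulus (c k).

    Lower bound (eigenvalue_lower).  The trace of (A / n) ^ p tends to the power
    sum of the c k of exponent p.  If all eigenvalues of A / n had modulus at
    most r, Schur's inequality (eigenvalues_trace) would bound this trace by a
    constant times r ^ p, uniformly in n.  A power sum cannot obey such a bound
    for every p when some modulus (c k) exceeds r (dominant_power_sum).

    The law of large numbers is obtained from second moments: the mean of n
    characters of nonzero frequency has second moment 1/n, which is summable
    along the squares, and between consecutive squares the sums move little
    (mean_cvg_of_squares). *)

(** * The complex modulus *)

Section modulus_theory.
Context {R : realType}.
Implicit Types x y z : R[i].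

Lemma normr_modulus z : `|z| = (modulus z)%:C.
Proof. by rewrite normc_def /modulus /=; case: z. Qed.

Lemma modulus_ge0 z : 0 <= modulus z.
Proof. by case: z => a b; exact: sqrtr_ge0. Qed.

Lemma modulus0 : modulus (0 : R[i]) = 0.
Proof. exact: ComplexField.Normc.normc0. Qed.

Lemma modulus0_eq0 z : modulus z = 0 -> z = 0.
Proof. exact: ComplexField.Normc.eq0_normc. Qed.

Lemma modulusM x y : modulus (x * y) = modulus x * modulus y.
Proof. exact: ComplexField.Normc.normcM. Qed.

Lemma modulusV x : modulus x^-1 = (modulus x)^-1.
Proof. exact: ComplexField.Normc.normcV. Qed.

Lemma modulusX x n : modulus (x ^+ n) = modulus x ^+ n.
Proof.
elim: n => [|n IH]; first exact: ComplexField.Normc.normc1.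
by rewrite !exprS modulusM IH.
Qed.

Lemma modulusN x : modulus (- x) = modulus x.
Proof. exact: (@normcN R x). Qed.

Lemma modulusB x y : modulus (x - y) = modulus (y - x).
Proof. by rewrite -modulusN opprB. Qed.

Lemma ler_modulusD x y : modulus (x + y) <= modulus x + modulus y.
Proof. exact: (@le_normcD R x y). Qed.

Lemma ler_modulus_dist x y : modulus x <= modulus y + modulus (x - y).
Proof. by rewrite -[x in X in X <= _](subrKC y); exact: ler_modulusD. Qed.

Lemma modulusJ x : modulus x^*%C = modulus x.
Proof. by case: x => a b; rewrite /modulus /= sqrrN. Qed.

Lemma modulus_nat n : modulus n%:R = n%:R :> R.
Proof.
have /complexI : (modulus (n%:R : R[i]))%:C = n%:R%:C by
  rewrite -normr_modulus normr_nat rmorph_nat.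
exact.
Qed.

Lemma ler_modulus_sum (I : Type) (r : seq I) (Q : pred I) (f : I -> R[i]) :
  modulus (\sum_(i <- r | Q i) f i) <= \sum_(i <- r | Q i) modulus (f i).
Proof.
elim/big_ind2: _ => //; first by rewrite modulus0.
by move=> a b a' b' h h'; rewrite (le_trans (ler_modulusD _ _))// lerD.
Qed.

Lemma ler_abs_Re z : `|complex.Re z| <= modulus z.
Proof.
case: z => a b; rewrite /modulus /= -sqrtr_sqr ler_sqrt; last first.
  by rewrite addr_ge0 ?sqr_ge0.
by rewrite lerDl sqr_ge0.
Qed.

Lemma ler_abs_Im z : `|complex.Im z| <= modulus z.
Proof.
case: z => a b; rewrite /modulus /= -sqrtr_sqr ler_sqrt; last first.
  by rewrite addr_ge0 ?sqr_ge0.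
by rewrite lerDr sqr_ge0.
Qed.

Lemma modulus_le_Re_Im z :
  modulus z <= `|complex.Re z| + `|complex.Im z|.
Proof.
case: z => a b; rewrite /modulus /= -[leRHS]ger0_norm ?addr_ge0//.
rewrite -[leRHS]sqrtr_sqr ler_sqrt ?sqr_ge0//.
by rewrite sqrrD !real_normK ?num_real// -addrA lerD2l lerDr mulrn_wge0 ?mulr_ge0.
Qed.

End modulus_theory.

(** * Entries and traces of matrix powers *)

Section entry_bounds.
Context {R : realType}.
Local Notation C := R[i].

Lemma modulus_mulmx_le m n p (M : 'M[C]_(m, n)) (N : 'M[C]_(n, p)) (a b : R) :
  (forall i j, modulus (M i j) <= a) -> (forall i j, modulus (N i j) <= b) ->
  forall i j, modulus ((M *m N) i j) <= n%:R * a * b.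
Proof.
move=> Ma Nb i j; rewrite mxE (le_trans (ler_modulus_sum _ _ _))//.
rewrite (le_trans (ler_sum _ (G := fun _ => a * b) _))//.
  by move=> k _; rewrite modulusM ler_pM ?modulus_ge0.
by rewrite sumr_const card_ord -mulrA mulr_natl.
Qed.

Lemma modulus_expmx_le n (M : 'M[C]_n) (a : R) p :
  (forall i j, modulus (M i j) <= a) ->
  forall i j, modulus ((M ^+ p.+1) i j) <= (n%:R * a) ^+ p * a.
Proof.
move=> Ma; elim: p => [|p IH] i j; first by rewrite expr0 mul1r expr1.
by rewrite exprS (le_trans (modulus_mulmx_le Ma IH _ _))// exprS !mulrA.
Qed.

(** Telescoping: M^(p+1) - N^(p+1) is a sum of p+1 products, each containing
    one factor M - N.  With a and e of order 1/n the bound is again of order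
    1/n, uniformly in the size n. *)
Lemma modulus_expmxB_le n (M N : 'M[C]_n) (a e : R) p :
  (forall i j, modulus (M i j) <= a) -> (forall i j, modulus (N i j) <= a) ->
  (forall i j, modulus ((M - N) i j) <= e) ->
  forall i j, modulus ((M ^+ p.+1 - N ^+ p.+1) i j) <= p.+1%:R * (n%:R * a) ^+ p * e.
Proof.
move=> Ma Na MNe; elim: p => [|p IH] i j.
  by rewrite expr0 !mul1r !expr1.
have -> : M ^+ p.+2 - N ^+ p.+2 =
    M *m (M ^+ p.+1 - N ^+ p.+1) + (M - N) *m N ^+ p.+1.
  by rewrite mulmxBr mulmxBl !mulmxE -!exprS addrA subrK.
rewrite mxE (le_trans (ler_modulusD _ _))//.
have h1 := modulus_mulmx_le Ma IH i j.
have h2 := modulus_mulmx_le MNe (modulus_expmx_le p Na) i j.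
rewrite (le_trans (lerD h1 h2))// [in leRHS]exprS -natr1.
by rewrite le_eqVlt; apply/orP; left; apply/eqP; ring.
Qed.

Lemma modulus_mxtrace_le n (M : 'M[C]_n) (a : R) :
  (forall i j, modulus (M i j) <= a) -> modulus (\tr M) <= n%:R * a.
Proof.
move=> Ma; rewrite /mxtrace (le_trans (ler_modulus_sum _ _ _))//.
rewrite (le_trans (ler_sum _ (G := fun _ => a) _))//.
by rewrite sumr_const card_ord mulr_natl.
Qed.

End entry_bounds.

(** Passes from an n x n matrix of rank at most m to an m x m matrix of
    fixed size. *)
Lemma mxtrace_mulmx_expC (C : comNzRingType) m n
    (U : 'M[C]_(n, m)) (V : 'M[C]_(m, n)) p :
  \tr ((U *m V) ^+ p.+1) = \tr ((V *m U) ^+ p.+1).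
Proof.
have expUV q : (U *m V) ^+ q.+1 = U *m (V *m U) ^+ q *m V.
  elim: q => [|q IH]; first by rewrite expr1 expr0 -idmxE mulmx1.
  by rewrite exprS IH [in RHS]exprS -!mulmxE !mulmxA.
by rewrite expUV mxtrace_mulC mulmxA mulmxE -exprS.
Qed.

Lemma diag_mx_exp (C : comNzRingType) n (d : 'rV[C]_n) p :
  diag_mx d ^+ p = diag_mx (\row_i d 0 i ^+ p).
Proof.
elim: p => [|p IH].
  by apply/matrixP => i j; rewrite expr0 !mxE; case: eqP => [->|] //=; rewrite ?eqxx.
rewrite exprS IH -mulmxE mul_diag_mx; apply/matrixP => i j; rewrite !mxE.
by rewrite exprS mulrnAr; case: eqP => // ->.
Qed.

(** * Schur's inequality *)

Section schur.
Local Open Scope sesquilinear_scope.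

Lemma char_poly_conj (C : comNzRingType) n (P Q A : 'M[C]_n) :
  P *m Q = 1%:M -> char_poly (P *m A *m Q) = char_poly A.
Proof.
move=> PQ; rewrite /char_poly.
pose P' := map_mx (@polyC C) P; pose Q' := map_mx (@polyC C) Q.
have PQ' : P' *m Q' = 1%:M by rewrite -map_mxM PQ map_mx1.
have -> : char_poly_mx (P *m A *m Q) = P' *m char_poly_mx A *m Q'.
  rewrite /char_poly_mx !map_mxM mulmxBr mulmxBl; congr (_ - _).
  by rewrite mul_mx_scalar -scalemxAl PQ' scalemx1.
by rewrite !det_mulmx mulrAC -det_mulmx PQ' det1 mul1r.
Qed.

Lemma trig_mulmx (C : comNzRingType) n (M N : 'M[C]_n) :
  is_trig_mx M -> is_trig_mx N ->
  is_trig_mx (M *m N) /\ forall i, (M *m N) i i = M i i * N i i.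
Proof.
move=> /is_trig_mxP Mt /is_trig_mxP Nt; split.
  apply/is_trig_mxP => i j ij; rewrite mxE big1// => k _.
  have [ik|ki] := ltnP i k; first by rewrite Mt// mul0r.
  by rewrite Nt ?mulr0// (leq_ltn_trans ki).
move=> i; rewrite mxE (bigD1 i)//= big1 ?addr0// => k ki.
have [ik|ik] := ltnP i k; first by rewrite Mt// mul0r.
by rewrite Nt ?mulr0// ltn_neqAle ik andbT.
Qed.

Lemma trig_expmx (C : comNzRingType) n (M : 'M[C]_n) p :
  is_trig_mx M -> is_trig_mx (M ^+ p) /\ forall i, (M ^+ p) i i = M i i ^+ p.
Proof.
move=> Mt; elim: p => [|p [IHt IHd]].
  split=> [|i]; last by rewrite !expr0 mxE eqxx.
  by rewrite expr0 -idmxE scalar_mx_is_trig.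
have [h1 h2] := trig_mulmx Mt IHt.
by rewrite exprS -mulmxE; split=> // i; rewrite h2 IHd exprS.
Qed.

(** A unitary triangularization keeps the sum of the squared moduli of the
    entries and puts the eigenvalues on the diagonal. *)
Lemma eigenvalues_trace (C : numClosedFieldType) n (A : 'M[C]_n) (l : 'I_n -> C) :
  char_poly A = \prod_(i < n) ('X - (l i)%:P) ->
  (forall p, \tr (A ^+ p) = \sum_i l i ^+ p) /\
  \sum_i `|l i| ^+ 2 <= \sum_i \sum_j `|A i j| ^+ 2.
Proof.
move=> charA; have [n0|n_gt0] := posnP n.
  by case: _ / (esym n0) in A l charA *; split=> [p|]; rewrite /mxtrace !big_ord0.
have [P Pu] := Schur A n_gt0.
rewrite /similar_to /= (conjymx _ Pu); set T := _ *m _ => Ttrig.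
have PP : P *m P^t* = 1%:M by apply/unitarymxP.
have PP' : P^t* *m P = 1%:M by apply: mulmx1C.
have perm_lT : perm_eq [seq l i | i <- enum 'I_n] [seq T i i | i <- enum 'I_n].
  apply: prod_XsubC_eq; rewrite big_map big_enum [RHS]big_map [RHS]big_enum /= -charA.
  by rewrite -(char_poly_trig Ttrig) char_poly_conj.
have sum_lT (f : C -> C) : \sum_i f (l i) = \sum_i f (T i i).
  have := perm_big _ perm_lT (op := +%R) (x := 0) (P := xpredT) (F := f).
  by rewrite [LHS]big_map big_enum [RHS]big_map big_enum.
have TX p : T ^+ p = P *m A ^+ p *m P^t*.
  elim: p => [|p IH]; first by rewrite !expr0 -idmxE mulmx1 PP.
  rewrite !exprS IH -!mulmxE /T !mulmxA -[P *m A *m P^t* *m P]mulmxA PP'.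
  by rewrite mulmx1.
have frob (M : 'M[C]_n) : \sum_i \sum_j `|M i j| ^+ 2 = \tr (M *m M^t*).
  apply: eq_bigr => i _; rewrite mxE; apply: eq_bigr => j _.
  by rewrite !mxE normCK.
split=> [p|].
  rewrite (sum_lT (fun x => x ^+ p)).
  rewrite -[A ^+ p]mulmx1 -PP' mulmxA mxtrace_mulC mulmxA -TX.
  by apply: eq_bigr => i _; rewrite (trig_expmx p Ttrig).2.
rewrite (sum_lT (fun x => `|x| ^+ 2)) [leRHS]frob.
have -> : \tr (A *m A^t*) = \tr (T *m T^t*).
  rewrite /T !trmx_mul !map_mxM !trmxCK !mulmxA -[_ *m P^t* *m P]mulmxA PP' mulmx1.
  by rewrite [in RHS]mxtrace_mulC !mulmxA PP' mul1mx.
rewrite -frob; apply: ler_sum => i _; rewrite (bigD1 i)//= lerDl.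
by apply: sumr_ge0 => j _; exact: exprn_ge0.
Qed.

End schur.

Section eigenvalue_power_sums.
Context {R : realType}.
Local Notation C := R[i].

(** Two of the p + 2 factors are spent on Schur's inequality, which removes
    the number of eigenvalues from the bound. *)
Lemma modulus_power_sum_le n (A : 'M[C]_n) (l : 'I_n -> C) (r b : R) p :
  char_poly A = \prod_(i < n) ('X - (l i)%:P) ->
  (forall i, modulus (l i) <= r) -> (forall i j, modulus (A i j) <= b) ->
  modulus (\tr (A ^+ p.+2)) <= r ^+ p * (n%:R * b) ^+ 2.
Proof.
move=> /eigenvalues_trace[trA frob] lr Ab; rewrite trA.
rewrite (le_trans (ler_modulus_sum _ _ _))//.
rewrite (@le_trans _ _ (r ^+ p * \sum_i modulus (l i) ^+ 2))//.
  rewrite mulr_sumr ler_sum// => i _.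
  rewrite -addn2 exprD modulusM !modulusX ler_wpM2r ?exprn_ge0 ?modulus_ge0//.
  by rewrite lerXn2r ?nnegrE ?modulus_ge0// (le_trans (modulus_ge0 (l i))).
have [n0|n_gt0] := posnP n.
  rewrite big1 => [|[i ilt]]; last by exfalso; rewrite n0 in ilt.
  by rewrite n0 mul0r expr0n.
have r_ge0 : 0 <= r.
  by apply: le_trans (lr (Ordinal n_gt0)); exact: modulus_ge0.
rewrite ler_wpM2l ?exprn_ge0//.
rewrite (@le_trans _ _ (\sum_i \sum_j modulus (A i j) ^+ 2))//.
  rewrite -lecR !rmorph_sum/=.
  under eq_bigr do rewrite rmorphXn/= -normr_modulus.
  under [leRHS]eq_bigr do rewrite rmorph_sum/=.
  by under [leRHS]eq_bigr do under eq_bigr do rewrite rmorphXn/= -normr_modulus.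
rewrite (le_trans (ler_sum _ (G := fun _ => \sum_(j < n) b ^+ 2) _))//.
  move=> i _; apply: ler_sum => j _.
  by rewrite lerXn2r ?nnegrE ?modulus_ge0// (le_trans (modulus_ge0 (A i j))).
by rewrite !sumr_const !card_ord -mulrnA exprMn -natrX mulr_natl mulnn.
Qed.

End eigenvalue_power_sums.

(** * Growth of power sums *)

Section dominant_power_sum.
Context {R : realType}.
Local Notation C := R[i].

Lemma unbounded_expr (x a : R) : 1 < x -> exists p, a < x ^+ p.
Proof.
move=> x1; have h0 : 0 < x - 1 by rewrite subr_gt0.
exists (Num.truncn (`|a| / (x - 1))).+1; set p := _.+1.
have bern q : 1 + q%:R * (x - 1) <= x ^+ q.
  elim: q => [|q IH]; first by rewrite expr0 mul0r addr0.
  have x0 : 0 <= x by rewrite ltW// (lt_trans _ x1).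
  rewrite exprS -natr1; have := ler_wpM2l x0 IH.
  have : 0 <= q%:R * (x - 1) ^+ 2 by rewrite mulr_ge0 ?sqr_ge0.
  by lra.
apply: lt_le_trans (bern p); apply: (@le_lt_trans _ _ `|a|); first exact: ler_norm.
by rewrite ltr_wpDl// -ltr_pdivrMr// truncnS_gt.
Qed.

(** The power sums may cancel for some exponents, but not for all of them.  Let
    q be the polynomial vanishing at every value of c except c k0.  The sum of
    the c k ^ p * q(c k) is then a nonzero multiple of c k0 ^ p, and it is also
    a fixed linear combination of consecutive power sums; were these all
    O(r^p), so would be modulus (c k0) ^ p. *)
Lemma dominant_power_sum m (c : 'I_m -> C) (k0 : 'I_m) (r B : R) :
  0 < r -> r < modulus (c k0) ->
  exists p, B * r ^+ p < modulus (\sum_k c k ^+ p.+2).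
Proof.
move=> r_gt0 rc; apply: contrapT => /forallNP small.
have {}small p : modulus (\sum_k c k ^+ p.+2) <= B * r ^+ p.
  by rewrite leNgt; apply/negP.
(* Distinct indices may carry the same value, hence the test on values. *)
pose q := \prod_(k | c k != c k0) ('X - (c k)%:P).
have qk0 : q.[c k0] != 0.
  rewrite horner_prod; apply/prodf_neq0 => k kk0.
  by rewrite hornerXsubC subr_eq0 eq_sym.
have qk k : q.[c k] = if c k == c k0 then q.[c k0] else 0.
  case: eqP => [->//|/eqP kk0].
  by rewrite /q horner_prod (bigD1 k)//= hornerXsubC subrr mul0r.
pose N := #|[pred k | c k == c k0]|.
have N_gt0 : (0 < N)%N by apply/card_gt0P; exists k0; rewrite inE.
have sumq p : \sum_k c k ^+ p.+2 * q.[c k] = N%:R * (c k0 ^+ p.+2 * q.[c k0]).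
  rewrite (bigID (fun k => c k == c k0))/= [X in _ + X]big1 ?addr0; last first.
    by move=> k /negPf kk0; rewrite qk kk0 mulr0.
  rewrite (eq_bigr (fun=> c k0 ^+ p.+2 * q.[c k0])); last first.
    by move=> k kk0; rewrite qk kk0 (eqP kk0).
  by rewrite sumr_const mulr_natl.
pose D := \sum_(j < size q) modulus q`_j * r ^+ j.
have bound p : modulus (\sum_k c k ^+ p.+2 * q.[c k]) <= B * D * r ^+ p.
  under eq_bigr do rewrite horner_coef mulr_sumr.
  rewrite exchange_big/= (le_trans (ler_modulus_sum _ _ _))//.
  rewrite mulrAC mulr_sumr; apply: ler_sum => j _.
  have -> : \sum_k c k ^+ p.+2 * (q`_j * c k ^+ j) =
      q`_j * \sum_k c k ^+ (p + j).+2.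
    rewrite mulr_sumr; apply: eq_bigr => k _.
    by rewrite mulrCA -exprD.
  rewrite modulusM [leRHS](_ : _ = modulus q`_j * (B * r ^+ (p + j))).
    by rewrite ler_wpM2l ?modulus_ge0.
  by rewrite exprD; ring.
set K := modulus (N%:R * c k0 ^+ 2 * q.[c k0]).
have K_gt0 : 0 < K.
  rewrite lt_def modulus_ge0 andbT; apply/eqP => /modulus0_eq0/eqP.
  rewrite mulf_eq0 (negPf qk0) orbF mulf_eq0 expf_eq0/= pnatr_eq0 gtn_eqF//=.
  by move=> /eqP c0; move: rc; rewrite c0 modulus0 ltNge ltW.
have ratio : 1 < modulus (c k0) / r by rewrite ltr_pdivlMr ?mul1r.
have [p] := unbounded_expr (B * D / K) ratio.
rewrite expr_div_n ltr_pdivlMr ?exprn_gt0// mulrAC ltr_pdivrMr//.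
apply/negP; rewrite -leNgt (le_trans _ (bound p))// sumq.
have -> : N%:R * (c k0 ^+ p.+2 * q.[c k0]) = c k0 ^+ p * (N%:R * c k0 ^+ 2 * q.[c k0]).
  by rewrite -addn2 exprD; ring.
by rewrite modulusM modulusX.
Qed.

End dominant_power_sum.

(** * Spectrum of nearly orthogonal superpositions *)

Section near_orthogonal.
Context {R : realType}.
Local Notation C := R[i].
Variables (n m : nat) (A : 'M[C]_n) (c : 'I_m -> C) (u : 'I_m -> 'I_n -> C).
Variables (S eps delta : R).
Hypothesis n_gt0 : (0 < n)%N.
Hypothesis u1 : forall k i, modulus (u k i) = 1.
Hypothesis cS : \sum_k modulus (c k) <= S.
Hypothesis approx :
  forall i j, modulus (A i j - \sum_k c k * u k i * (u k j)^*%C) <= eps.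

(** The Gram matrix of the u k for the normalized Hermitian product. *)
Definition gram k l : C := n%:R^-1 * \sum_i u l i * (u k i)^*%C.

Hypothesis delta_ge0 : 0 <= delta.
Hypothesis gram_small : forall k l, k != l -> modulus (gram k l) <= delta.

Let nR_neq0 : n%:R != 0 :> R. Proof. by rewrite pnatr_eq0 -lt0n. Qed.
Let nC_neq0 : n%:R != 0 :> C. Proof. by rewrite pnatr_eq0 -lt0n. Qed.

Lemma modulus_unit_conj (z : C) : modulus z = 1 -> z * z^*%C = 1.
Proof.
by move=> z1; have := sqr_normc z; rewrite normr_modulus z1 => <-; rewrite expr1n.
Qed.

Lemma gram_diag k : gram k k = 1.
Proof.
rewrite /gram (eq_bigr (fun=> 1)) => [|i _]; last by rewrite modulus_unit_conj.
by rewrite sumr_const card_ord mulVf.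
Qed.

Lemma modulus_coef_le k : modulus (c k) <= S.
Proof.
apply: le_trans cS; rewrite (bigD1 k)//= lerDl sumr_ge0// => i _.
exact: modulus_ge0.
Qed.

Lemma mean_le (f : 'I_n -> C) (b : R) : (forall i, modulus (f i) <= b) ->
  modulus (n%:R^-1 * \sum_i f i) <= b.
Proof.
move=> fb; rewrite modulusM modulusV modulus_nat mulrC ler_pdivrMr ?ltr0n//.
rewrite (le_trans (ler_modulus_sum _ _ _))//.
rewrite (le_trans (ler_sum _ (G := fun=> b) _))//.
by rewrite sumr_const card_ord mulr_natr.
Qed.

(** Let x be a left eigenvector, X its largest modulus, y k its mean against
    u k and Y the largest modulus of the y k.  The eigenvector equation gives
    L X <= S Y + eps X with L = modulus lam / n; its means against the u l,
    which the Gram matrix almost diagonalizes, give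
    (L - mu) Y <= S delta Y + eps X.  If L >= mu + eta, the second inequality
    makes Y small compared with X, against the first one. *)
Lemma eigenvalue_upper (mu eta : R) (lam : C) :
  (forall k, modulus (c k) <= mu) -> 0 < eta -> 0 <= mu ->
  S * delta <= eta / 2 -> eps * (1 + 2 * S / eta) < mu + eta ->
  root (char_poly A) lam -> modulus lam / n%:R < mu + eta.
Proof.
move=> cmu eta_gt0 mu_ge0 Sdelta Seps; rewrite -eigenvalue_root_char.
move=> /eigenvalueP[x xA x_neq0]; rewrite ltNge; apply/negP => lam_ge.
set L := modulus lam / n%:R in lam_ge.
have L_gt0 : 0 < L by rewrite (lt_le_trans _ lam_ge)// ltr_wpDl.
have S_ge0 : 0 <= S.
  by apply: le_trans cS; rewrite sumr_ge0// => k _; exact: modulus_ge0.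
have eps_ge0 : 0 <= eps.
  apply: le_trans (approx (Ordinal n_gt0) (Ordinal n_gt0)).
  exact: modulus_ge0.
pose y k := n%:R^-1 * \sum_i x 0 i * u k i.
pose E i j := A i j - \sum_k c k * u k i * (u k j)^*%C.
pose e j := n%:R^-1 * \sum_i x 0 i * E i j.
pose X := \big[Num.max/0]_i modulus (x 0 i).
pose Y := \big[Num.max/0]_k modulus (y k).
have xX i : modulus (x 0 i) <= X by exact: le_bigmax.
have yY k : modulus (y k) <= Y by exact: le_bigmax.
have X_ge0 : 0 <= X by exact: bigmax_ge_id.
have Y_ge0 : 0 <= Y by exact: bigmax_ge_id.
have X_gt0 : 0 < X.
  rewrite lt_neqAle X_ge0 andbT eq_sym; apply: contra x_neq0 => /eqP X0.
  apply/eqP/rowP => i; rewrite mxE; apply: modulus0_eq0; apply/eqP.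
  by rewrite eq_le modulus_ge0 andbT -X0 xX.
have eX j : modulus (e j) <= eps * X.
  apply: mean_le => i; rewrite modulusM mulrC ler_pM ?modulus_ge0//.
  exact: approx.
(* The eigenvector equation, read coordinate by coordinate. *)
have eqx j : n%:R^-1 * lam * x 0 j = \sum_k c k * y k * (u k j)^*%C + e j.
  have -> : n%:R^-1 * lam * x 0 j = n%:R^-1 * (x *m A) 0 j.
    by rewrite xA mxE mulrA.
  rewrite mxE /e.
  have -> : \sum_k c k * y k * (u k j)^*%C =
      n%:R^-1 * \sum_i x 0 i * \sum_k c k * u k i * (u k j)^*%C.
    rewrite mulr_sumr.
    under [RHS]eq_bigr do rewrite mulr_sumr mulr_sumr.
    rewrite exchange_big/=; apply: eq_bigr => k _.
    rewrite /y mulrA mulr_sumr mulr_suml.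
    by apply: eq_bigr => i _; ring.
  rewrite -mulrDr -big_split/=; congr (_ * _); apply: eq_bigr => i _.
  by rewrite -mulrDr /E addrC subrK.
(* Its projections on the vectors u l. *)
have eqy l : n%:R^-1 * lam * y l =
    \sum_k c k * y k * gram k l + n%:R^-1 * \sum_j e j * u l j.
  rewrite {1}/y mulrCA [X in _ * X = _]mulr_sumr (eq_bigr (fun j =>
    \sum_k c k * y k * (u l j * (u k j)^*%C) + e j * u l j)); last first.
    move=> j _; rewrite mulrA eqx mulrDl; congr (_ + _).
    by rewrite mulr_suml; apply: eq_bigr => k _; ring.
  rewrite big_split/= mulrDr exchange_big/=; congr (_ + _).
  rewrite mulr_sumr; apply: eq_bigr => k _.
  by rewrite -mulr_sumr /gram; ring.
have LE z : modulus (n%:R^-1 * lam * z) = L * modulus z.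
  by rewrite !modulusM modulusV modulus_nat [_^-1 * _]mulrC.
have XY : L * X <= S * Y + eps * X.
  rewrite -ler_pdivlMl//; apply: bigmax_le => [|j _].
    by rewrite mulr_ge0 ?invr_ge0 ?(ltW L_gt0)// addr_ge0 ?mulr_ge0.
  rewrite ler_pdivlMl// -LE eqx (le_trans (ler_modulusD _ _))// lerD//.
  rewrite (le_trans (ler_modulus_sum _ _ _))//.
  rewrite (@le_trans _ _ (\sum_k modulus (c k) * Y))//.
    apply: ler_sum => k _; rewrite 2!modulusM modulusJ u1 mulr1.
    by rewrite ler_wpM2l ?modulus_ge0.
  by rewrite -mulr_suml ler_wpM2r.
have YX : (L - mu) * Y <= S * delta * Y + eps * X.
  have Lmu : 0 < L - mu by rewrite subr_gt0 (lt_le_trans _ lam_ge)// ltrDl.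
  have other l : \sum_(k | k != l) modulus (c k * y k * gram k l) <= S * delta * Y.
    rewrite (@le_trans _ _ (\sum_(k | k != l) modulus (c k) * (delta * Y)))//.
      apply: ler_sum => k kl; rewrite 2!modulusM -mulrA ler_wpM2l ?modulus_ge0//.
      by rewrite mulrC ler_pM ?modulus_ge0 ?gram_small.
    rewrite -mulr_suml -mulrA ler_wpM2r ?mulr_ge0 //.
    apply: le_trans cS; rewrite [leRHS](bigID (fun k => k != l))/= lerDl.
    by rewrite sumr_ge0// => k _; exact: modulus_ge0.
  rewrite -ler_pdivlMl//; apply: bigmax_le => [|l _].
    by rewrite mulr_ge0 ?invr_ge0 ?(ltW Lmu)// addr_ge0 ?mulr_ge0.
  rewrite ler_pdivlMl// mulrBl lerBlDr -LE eqy.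
  rewrite (le_trans (ler_modulusD _ _))// addrAC lerD//; last first.
    by apply: mean_le => j; rewrite modulusM u1 mulr1.
  rewrite (bigD1 l)//= gram_diag mulr1 (le_trans (ler_modulusD _ _))// [leRHS]addrC.
  apply: lerD; first by rewrite modulusM ler_wpM2r ?modulus_ge0.
  exact: le_trans (ler_modulus_sum _ _ _) (other l).
(* The errors were chosen so that S * delta uses half of the gap eta. *)
have Yle : eta / 2 * Y <= eps * X.
  have h1 : eta * Y <= (L - mu) * Y by rewrite ler_wpM2r// lerBrDl.
  have h2 : S * delta * Y <= eta / 2 * Y by rewrite ler_wpM2r.
  by lra.
have : (mu + eta) * X <= eps * (1 + 2 * S / eta) * X.
  apply: (@le_trans _ _ (L * X)); first by rewrite ler_wpM2r.
  rewrite (le_trans XY)// mulrDr mulr1 mulrDl [leRHS]addrC lerD2r.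
  have -> : eps * (2 * S / eta) * X = S * (2 / eta * (eps * X)) by ring.
  rewrite ler_wpM2l// -ler_pdivrMl ?divr_gt0//.
  by rewrite invf_div.
by rewrite ler_pM2r// leNgt Seps.
Qed.

Lemma scale_expmx (a : C) p : (a *: A) ^+ p = a ^+ p *: A ^+ p.
Proof.
elim: p => [|p IH]; first by rewrite !expr0 scale1r.
by rewrite !exprS IH -!mulmxE -scalemxAl -scalemxAr scalerA.
Qed.

(** The first term comes from replacing A by its finite superposition, the
    second one from replacing the Gram matrix by the identity; for fixed m and
    p both are as small as eps and delta. *)
Definition power_sum_error p : R :=
  p.+1%:R * S ^+ p * eps + m%:R * (p.+1%:R * (m%:R * S) ^+ p * (S * delta)).

Hypothesis AS : forall i j, modulus (A i j) <= S.

(** The superposition, divided by n, factors as U V with V U = diag(c) * gram,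
    close to diag(c), and traces of powers do not see the difference between
    U V and V U. *)
Lemma trace_near_power_sum p :
  modulus (\tr ((n%:R^-1 *: A) ^+ p.+1) - \sum_k c k ^+ p.+1) <= power_sum_error p.
Proof.
pose U : 'M[C]_(n, m) := \matrix_(i, k) u k i.
pose V : 'M[C]_(m, n) := \matrix_(k, j) (n%:R^-1 * (c k * (u k j)^*%C)).
have S_ge0 : 0 <= S.
  by apply: le_trans cS; rewrite sumr_ge0// => k _; exact: modulus_ge0.
have UVE i j : (U *m V) i j = n%:R^-1 * \sum_k c k * u k i * (u k j)^*%C.
  by rewrite mxE mulr_sumr; apply: eq_bigr => k _; rewrite !mxE; ring.
have VUE k l : (V *m U) k l = c k * gram k l.
  rewrite mxE /gram !mulr_sumr; apply: eq_bigr => j _.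
  by rewrite !mxE; ring.
have nV_modulus z : modulus (n%:R^-1 * z) = n%:R^-1 * modulus z.
  by rewrite modulusM modulusV modulus_nat.
have nS : n%:R * (n%:R^-1 * S) = S by rewrite mulrA mulfV// mul1r.
have n_ge0 : 0 <= n%:R^-1 :> R by rewrite invr_ge0.
have gram_le k l : modulus (gram k l) <= 1.
  by apply: mean_le => i; rewrite modulusM modulusJ !u1 mulr1.
have tr1 : modulus (\tr ((n%:R^-1 *: A) ^+ p.+1) - \tr ((U *m V) ^+ p.+1)) <=
    p.+1%:R * S ^+ p * eps.
  rewrite -[_ - _]raddfB/=.
  have -> : p.+1%:R * S ^+ p * eps =
      n%:R * (p.+1%:R * (n%:R * (n%:R^-1 * S)) ^+ p * (n%:R^-1 * eps)).
    by rewrite nS; field.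
  apply: modulus_mxtrace_le; apply: modulus_expmxB_le => i j.
  - by rewrite mxE nV_modulus ler_wpM2l.
  - rewrite UVE nV_modulus ler_wpM2l// (le_trans (ler_modulus_sum _ _ _))//.
    by under eq_bigr do rewrite modulusM modulusJ modulusM !u1 !mulr1.
  - by rewrite mxE [X in _ + X]mxE UVE mxE -mulrBr nV_modulus ler_wpM2l.
have tr2 : modulus (\tr ((V *m U) ^+ p.+1) - \sum_k c k ^+ p.+1) <=
    m%:R * (p.+1%:R * (m%:R * S) ^+ p * (S * delta)).
  pose D : 'M[C]_m := diag_mx (\row_k c k).
  have -> : \sum_k c k ^+ p.+1 = \tr (D ^+ p.+1).
    rewrite diag_mx_exp mxtrace_diag; apply: eq_bigr => k _.
    by rewrite !mxE.
  rewrite -[_ - _]raddfB/=.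
  apply: modulus_mxtrace_le; apply: modulus_expmxB_le => k l.
  - rewrite VUE modulusM -[leRHS]mulr1 ler_pM ?modulus_ge0//.
    exact: modulus_coef_le.
  - rewrite !mxE; case: eqP => _; first by rewrite mulr1n modulus_coef_le.
    by rewrite mulr0n modulus0.
  - rewrite mxE VUE !mxE; case: eqVneq => [->|kl].
      by rewrite gram_diag mulr1 mulr1n subrr modulus0 mulr_ge0.
    rewrite mulr0n subr0 modulusM ler_pM ?modulus_ge0 ?gram_small//.
    exact: modulus_coef_le.
rewrite -mxtrace_mulmx_expC in tr2.
rewrite -(subrKA (\tr ((U *m V) ^+ p.+1))) (le_trans (ler_modulusD _ _))//.
exact: lerD.
Qed.

(** Hence a power sum exceeding the right-hand side forces an eigenvalue of
    modulus greater than n * r. *)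
Lemma eigenvalue_lower (l : 'I_n -> C) (r : R) p :
  char_poly A = \prod_(i < n) ('X - (l i)%:P) ->
  (forall i, modulus (l i) / n%:R <= r) ->
  modulus (\sum_k c k ^+ p.+2) <= r ^+ p * S ^+ 2 + power_sum_error p.+1.
Proof.
move=> charA lr.
have nlr i : modulus (l i) <= n%:R * r by rewrite mulrC -ler_pdivrMr ?ltr0n.
have trA := modulus_power_sum_le p charA nlr AS.
rewrite (le_trans (ler_modulus_dist _ (\tr ((n%:R^-1 *: A) ^+ p.+2))))//.
rewrite modulusB lerD ?trace_near_power_sum//.
rewrite scale_expmx mxtraceZ modulusM modulusX modulusV modulus_nat.
rewrite exprVn ler_pdivrMl ?exprn_gt0 ?ltr0n//.
have -> : n%:R ^+ p.+2 * (r ^+ p * S ^+ 2) = (n%:R * r) ^+ p * (n%:R * S) ^+ 2.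
  by rewrite !exprMn -addn2 exprD; ring.
exact: trA.
Qed.

End near_orthogonal.

(** * Absolutely summable families *)

Section summable_families.
Context {R : realType} {I : choiceType}.
Local Notation C := R[i].
Implicit Types (c : I -> C) (J K : {fset I}).

Lemma big_fset_subset (V : nmodType) (f : I -> V) J K : (K `<=` J)%fset ->
  \sum_(k <- J) f k = \sum_(k <- K) f k + \sum_(k <- (J `\` K)%fset) f k.
Proof.
move=> KJ; rewrite (big_fsetID _ (mem K) J)/=; congr (_ + _).
- congr (\sum_(_ <- _) _); congr enum_fset; apply/fsetP => k; rewrite !inE /=.
  by apply: andb_idl => /(fsubsetP KJ).
- congr (\sum_(_ <- _) _); congr enum_fset; apply/fsetP => k; rewrite !inE /=.
  by rewrite andbC.
Qed.

Lemma has_sumP (f : I -> C) (s : C) (e : R) : has_sum f s -> 0 < e ->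
  exists K, forall J, (K `<=` J)%fset -> modulus (s - \sum_(k <- J) f k) <= e.
Proof.
move=> fs e_gt0.
have /cvgrPdist_le/(_ e%:C) := fs.
have tF : Filter (@totally I) by apply: (@filter_filter _ _ totally_filter).
rewrite ltcR => /(_ tF e_gt0)[K _ sub]; exists K => J KJ.
have := sub J KJ; rewrite /partial_sum -(big_seq_fsetE _ J xpredT f)/=.
by rewrite normr_modulus lecR.
Qed.

(** Absolute summability is used only through its tails, so it is stated with
    finite sums. *)
Definition small_tail c (e : R) K :=
  forall J, [disjoint K & J]%fset -> \sum_(k <- J) modulus (c k) <= e.

(** Split J according to the sign of g. *)
Lemma sum_normr_fset (g : I -> R) J (b : R) :
  (forall J', (J' `<=` J)%fset -> `|\sum_(k <- J') g k| <= b) ->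
  \sum_(k <- J) `|g k| <= 2 * b.
Proof.
move=> gb; rewrite (bigID (fun k => 0 <= g k))/=.
have := gb [fset k in J | 0 <= g k]%fset; rewrite -big_fset_condE.
have := gb [fset k in J | ~~ (0 <= g k)]%fset; rewrite -big_fset_condE.
rewrite !fset_sub => /(_ isT)/ler_normlP[h1 h2] /(_ isT)/ler_normlP[h3 h4].
rewrite (eq_bigr g); last by move=> k /ger0_norm.
rewrite [X in _ + X](eq_bigr (fun k => - g k)); last first.
  by move=> k; rewrite -ltNge => /ltr0_norm.
by rewrite sumrN; lra.
Qed.

(** Unconditional convergence is absolute in finite dimension: Cauchy's
    criterion bounds all the sums over finite subsets of a set disjoint from K,
    and sum_normr_fset applies to the real and imaginary parts. *)
Lemma has_sum_small_tail c s : has_sum c s ->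
  forall e, 0 < e -> exists K, small_tail c e K.
Proof.
move=> cs e e_gt0; have e8 : 0 < e / 8 by lra.
have [K sK] := has_sumP cs e8; exists K => J KJ.
have small J' : (J' `<=` J)%fset -> modulus (\sum_(k <- J') c k) <= e / 4.
  move=> J'J; have h1 := sK K (fsubset_refl K).
  have h2 := sK (K `|` J')%fset (fsubsetUl K J').
  have -> : \sum_(k <- J') c k =
      (s - \sum_(k <- K) c k) - (s - \sum_(k <- (K `|` J')%fset) c k).
    rewrite (@big_fset_subset _ c (K `|` J')%fset K) ?fsubsetUl//.
    have -> : ((K `|` J') `\` K = J')%fset.
      rewrite fsetDUl fsetDv fset0U; apply/fsetDidPl.
      by rewrite fdisjoint_sym (fdisjointWr J'J).
    by ring.
  rewrite (le_trans (ler_modulusD _ _))// modulusN.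
  by lra.
have hRe : \sum_(k <- J) `|complex.Re (c k)| <= 2 * (e / 4).
  apply: sum_normr_fset => J' /small; apply: le_trans.
  by rewrite -(raddf_sum (@complex.Re R)) ler_abs_Re.
have hIm : \sum_(k <- J) `|complex.Im (c k)| <= 2 * (e / 4).
  apply: sum_normr_fset => J' /small; apply: le_trans.
  by rewrite -(raddf_sum (@complex.Im R)) ler_abs_Im.
rewrite (le_trans (ler_sum _ (fun k _ => modulus_le_Re_Im (c k))))//.
by rewrite big_split/=; lra.
Qed.

Lemma small_tailW c e K K' : (K `<=` K')%fset -> small_tail c e K ->
  small_tail c e K'.
Proof. by move=> KK' tK J /(fdisjointWl KK'); exact: tK. Qed.

Lemma small_tail_coef c e K k : small_tail c e K -> k \notin K ->
  modulus (c k) <= e.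
Proof.
move=> tK kK; have := tK [fset k]%fset; rewrite big_seq_fset1; apply.
by rewrite fdisjointX1.
Qed.

(** The error of truncating to K is bounded by the tail, uniformly in the
    unimodular factors. *)
Lemma has_sum_truncate c (z : I -> C) (s : C) e K :
  small_tail c e K -> (forall k, modulus (z k) = 1) ->
  has_sum (fun k => c k * z k) s ->
  modulus (s - \sum_(k <- K) c k * z k) <= e.
Proof.
move=> tK z1 cs; apply/ler_addgt0Pr => h h_gt0.
have [K1 sK1] := has_sumP cs h_gt0.
have := sK1 (K `|` K1)%fset (fsubsetUr _ _).
set S := \sum_(k <- (_ `|` _)%fset) _ => sS.
rewrite -(subrKA S) (le_trans (ler_modulusD _ _))// addrC lerD//.
rewrite /S (@big_fset_subset _ _ (K `|` K1)%fset K) ?fsubsetUl// addrAC subrr add0r.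
rewrite (le_trans (ler_modulus_sum _ _ _))//.
under eq_bigr do rewrite modulusM z1 mulr1.
by apply: tK; apply/fdisjointP => k kK; rewrite !inE kK.
Qed.

(** Outside of a finite set all values are at most half of a given nonzero
    one. *)
Lemma exists_max_modulus c (i0 : I) :
  (forall e, 0 < e -> exists K, small_tail c e K) ->
  exists k0, forall k, modulus (c k) <= modulus (c k0).
Proof.
move=> tc; have [[k1 c1]|c0] := pselect (exists k1, c k1 != 0); last first.
  exists i0 => k; suff -> : c k = 0 by rewrite modulus0 modulus_ge0.
  by apply: contrapT => /eqP ck; apply: c0; exists k.
have c1_gt0 : 0 < modulus (c k1).
  rewrite lt_def modulus_ge0 andbT; apply: contra c1 => /eqP.
  by move/modulus0_eq0 => ->.
have c1_half : 0 < modulus (c k1) / 2 by rewrite divr_gt0.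
have [K tK] := tc _ c1_half.
have k1K : k1 \in K.
  by apply: contraT => /(small_tail_coef tK); lra.
pose k0 := [arg max_(k > [` k1K]%fset) modulus (c (val k))]%O.
have k0max (k : K) : modulus (c (val k)) <= modulus (c (val k0)).
  by rewrite /k0; case: arg_maxP => // j _; apply.
exists (val k0) => k; have [kK|kK] := boolP (k \in K).
  exact: (k0max [` kK]%fset).
apply: le_trans (small_tail_coef tK kK) _.
by apply: le_trans (k0max [` k1K]%fset) => /=; lra.
Qed.

End summable_families.

(** * Deterministic limit of the spectral radius *)

Lemma exists_small_factor (R : realType) (a b : R) : 0 <= a -> 0 < b ->
  exists2 e, 0 < e & a * e <= b.
Proof.
move=> a_ge0 b_gt0; have a1 : 0 < a + 1 by rewrite ltr_wpDl.
exists (b / (a + 1)); first by rewrite divr_gt0.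
by rewrite mulrCA ler_piMr ?(ltW b_gt0)// ler_pdivrMr// mul1r; lra.
Qed.

(** The matrices A n are superpositions of the rank-one matrices
    (e k i * conj (e k j)) with absolutely summable weights c k, and the vectors
    e k become orthogonal for the Hermitian product divided by n. *)
Section spectral_limit.
Context {R : realType} {I : choiceType}.
Local Notation C := R[i].
Variables (c : I -> C) (e : I -> nat -> C) (A : forall n, 'M[C]_n).
Variables (l : forall n, 'I_n -> C) (k0 : I).
Hypothesis c_tail : forall eps, 0 < eps -> exists K, small_tail c eps K.
Hypothesis c_max : forall k, modulus (c k) <= modulus (c k0).
Hypothesis e1 : forall k i, modulus (e k i) = 1.
Hypothesis A_series : forall n (i j : 'I_n),
  has_sum (fun k => c k * (e k i * (e k j)^*%C)) (A n i j).
Hypothesis e_orth : forall k k', k != k' ->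
  modulus (n%:R^-1 * \sum_(i < n) e k' i * (e k i)^*%C) @[n --> \oo] --> 0.
Hypothesis l_eig : forall n, char_poly (A n) = \prod_(i < n) ('X - (l i)%:P).

Let mu := modulus (c k0).

(* Finite sets of indices are enumerated by ordinals to be used with matrices. *)
Let idx (K : {fset I}) : 'I_(size K) -> I := tnth (in_tuple K).

Let idx_inj K : injective (@idx K).
Proof. by apply/tuple_uniqP; exact: fset_uniq. Qed.

Let sum_idx (V : nmodType) (K : {fset I}) (f : I -> V) :
  \sum_(k < size K) f (idx k) = \sum_(k <- K) f k.
Proof. by rewrite [RHS]big_tnth. Qed.

Let truncated (eps : R) (K : {fset I}) : small_tail c eps K ->
  forall n (i j : 'I_n), modulus (A n i j -
    \sum_(k < size K) c (idx k) * e (idx k) i * (e (idx k) j)^*%C) <= eps.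
Proof.
move=> tK n i j; rewrite (sum_idx K (fun k => c k * e k i * (e k j)^*%C)).
under eq_bigr do rewrite -mulrA.
apply: (@has_sum_truncate R I c (fun k => e k i * (e k j)^*%C) (A n i j) eps K).
- exact: tK.
- by move=> k; rewrite modulusM modulusJ !e1 mulr1.
- exact: A_series.
Qed.

Let bounded : exists S, [/\ 0 <= S,
  forall K : {fset I}, \sum_(k < size K) modulus (c (idx k)) <= S &
  forall n (i j : 'I_n), modulus (A n i j) <= S].
Proof.
have [K tK] := c_tail ltr01.
have sum_ge0 : 0 <= \sum_(k <- K) modulus (c k).
  by apply: sumr_ge0 => k _; exact: modulus_ge0.
exists (\sum_(k <- K) modulus (c k) + 1); split => [|J|n i j].
- by rewrite addr_ge0.
- rewrite (sum_idx J (fun k => modulus (c k))).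
  apply: (@le_trans _ _ (\sum_(k <- (K `|` J)%fset) modulus (c k))).
    rewrite (@big_fset_subset _ _ _ (K `|` J)%fset J) ?fsubsetUr// lerDl.
    by apply: sumr_ge0 => k _; exact: modulus_ge0.
  rewrite (@big_fset_subset _ _ _ (K `|` J)%fset K) ?fsubsetUl// lerD2l.
  by apply: tK; apply/fdisjointP => k kK; rewrite !inE kK.
- apply: le_trans (ler_modulus_dist _ _) (lerD _ (truncated tK i j)).
  rewrite (le_trans (ler_modulus_sum _ _ _))//.
  under eq_bigr do rewrite !modulusM modulusJ !e1 !mulr1.
  by rewrite (sum_idx K (fun k => modulus (c k))).
Qed.

Let gram_near (K : {fset I}) (delta : R) : 0 < delta -> \forall n \near \oo,
  forall k k' : 'I_(size K), k != k' ->
  modulus (@gram R n (size K) (fun k i => e (idx k) i) k k') <= delta.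
Proof.
move=> d_gt0; apply: filter_forall => k; apply: filter_forall => k'.
have [->|kk'] := eqVneq k k'; first by near=> n.
have /cvgrPdist_le/(_ _ d_gt0) := e_orth (contra_neq (@idx_inj K _ _) kk').
apply: filterS => n /= + _; rewrite sub0r normrN ger0_norm ?modulus_ge0//.
Unshelve. all: by end_near. Qed.

Lemma spectral_upper (eta : R) : 0 < eta ->
  \forall n \near \oo, forall i : 'I_n, modulus (l i) / n%:R < mu + eta.
Proof.
move=> eta_gt0; have mu_ge0 : 0 <= mu by exact: modulus_ge0.
have [S [S_ge0 cS _]] := bounded.
have B_ge0 : 0 <= 1 + 2 * S / eta.
  by rewrite addr_ge0// divr_ge0 ?mulr_ge0 ?(ltW eta_gt0).
have [eps eps_gt0 epsS] := exists_small_factor B_ge0 eta_gt0.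
have eps2 : eps / 2 * (1 + 2 * S / eta) < mu + eta.
  rewrite mulrC mulrA ltr_pdivrMr//; apply: le_lt_trans epsS _.
  by lra.
have [delta delta_gt0 deltaS] := exists_small_factor S_ge0 (divr_gt0 eta_gt0 (ltr0Sn R 1)).
have [K tK] := c_tail (divr_gt0 eps_gt0 (ltr0Sn R 1)).
near=> n => i; apply: (@eigenvalue_upper R n (size K) (A n) (fun k => c (idx k))
  (fun k i => e (idx k) i) S (eps / 2) delta) => //.
- by near: n; exact: nbhs_infty_gt.
- exact: truncated.
- exact: ltW.
- by near: n; exact: gram_near.
- by rewrite l_eig rootE horner_prod (bigD1 i)//= hornerXsubC subrr mul0r.
Unshelve. all: by end_near. Qed.

(** The exponent p is chosen first, from a finite set K1 whose tail is at most
    r; enlarging K1 then changes the power sum by at most r ^ (p+2).  Afterwards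
    eps, the finite set K and finally delta are chosen for this p. *)
Lemma spectral_lower (r : R) : 0 < r -> r < mu ->
  \forall n \near \oo, exists i : 'I_n, r < modulus (l i) / n%:R.
Proof.
move=> r_gt0 r_mu; have [S [S_ge0 cS AS]] := bounded.
have [K1 tK1] := c_tail r_gt0.
have k0K1 : k0 \in K1.
  by apply: contraT => /(small_tail_coef tK1); rewrite leNgt r_mu.
have [p0 p0P] : exists p0 : 'I_(size K1), idx p0 = k0.
  have k0lt : (index k0 K1 < size K1)%N by rewrite index_mem.
  by exists (Ordinal k0lt); rewrite /idx (tnth_nth k0) /= nth_index.
have [p] := @dominant_power_sum R (size K1) (fun k => c (idx k)) p0 r
  (S ^+ 2 + 1 + r ^+ 2) r_gt0 (eq_ind_r (fun k => r < modulus (c k)) r_mu p0P).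
rewrite (sum_idx K1 (fun k => c k ^+ p.+2)) => big.
have rp_gt0 : 0 < r ^+ p / 2 by rewrite divr_gt0 ?exprn_gt0.
have a_ge0 : 0 <= p.+2%:R * S ^+ p.+1 by rewrite mulr_ge0 ?exprn_ge0.
have [eps eps_gt0 epsS] := exists_small_factor a_ge0 rp_gt0.
have [K2 tK2] := c_tail eps_gt0.
pose K := (K1 `|` K2)%fset.
have tK : small_tail c eps K := small_tailW (fsubsetUr _ _) tK2.
pose m := size K.
have b_ge0 : 0 <= m%:R * (p.+2%:R * (m%:R * S) ^+ p.+1 * S).
  by rewrite !mulr_ge0 ?exprn_ge0 ?mulr_ge0.
have [delta delta_gt0 deltaS] := exists_small_factor b_ge0 rp_gt0.
have bigK : r ^+ p * S ^+ 2 + r ^+ p < modulus (\sum_(k <- K) c k ^+ p.+2).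
  have rest : modulus (\sum_(k <- (K `\` K1)%fset) c k ^+ p.+2) <= r ^+ p.+2.
    rewrite (le_trans (ler_modulus_sum _ _ _))//.
    apply: (@le_trans _ _ (\sum_(k <- (K `\` K1)%fset) modulus (c k) * r ^+ p.+1)).
      rewrite big_seq [leRHS]big_seq; apply: ler_sum => k.
      rewrite inE => /andP[kK1 _]; have ckr := small_tail_coef tK1 kK1.
      rewrite modulusX exprS ler_wpM2l ?modulus_ge0//.
      by rewrite lerXn2r ?nnegrE ?modulus_ge0 ?(ltW r_gt0).
    rewrite -mulr_suml [leRHS]exprS ler_wpM2r ?exprn_ge0 ?(ltW r_gt0)//.
    by apply: tK1; apply/fdisjointP => k kK1; rewrite !inE kK1.
  rewrite (@big_fset_subset _ _ (fun k => c k ^+ p.+2) K K1) ?fsubsetUl//.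
  set s1 := \sum_(k <- K1) _ in big *; set s2 := \sum_(k <- _) _ in rest *.
  have := ler_modulus_dist s1 (s1 + s2).
  rewrite [s1 - _]addrC opprD addrAC addNr add0r modulusN => h1.
  have h2 : (S ^+ 2 + 1 + r ^+ 2) * r ^+ p = r ^+ p * S ^+ 2 + r ^+ p + r ^+ p.+2.
    by rewrite -[p.+2]addn2 exprD; ring.
  by rewrite h2 in big; lra.
near=> n; apply: contrapT => /forallNP small.
have {}small (i : 'I_n) : modulus (l i) / n%:R <= r by rewrite leNgt; apply/negP.
have n_gt0 : (0 < n)%N by near: n; exact: nbhs_infty_gt.
have gn : forall k k' : 'I_(size K), k != k' ->
    modulus (@gram R n (size K) (fun k i => e (idx k) i) k k') <= delta.
  by near: n; exact: gram_near.
have := @eigenvalue_lower R n (size K) (A n) (fun k => c (idx k))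
  (fun k i => e (idx k) i) S eps delta n_gt0 (fun k i => e1 (idx k) i) (cS K) (fun i j => truncated tK i j)
  (ltW delta_gt0) gn (AS n) (@l n) r p (l_eig n) small.
rewrite (sum_idx K (fun k => c k ^+ p.+2)) /power_sum_error -/m.
apply/negP; rewrite -ltNge; apply: le_lt_trans bigK.
rewrite lerD2l [leRHS](splitr (r ^+ p)) lerD//.
by move: deltaS; rewrite !mulrA.
Unshelve. all: by end_near. Qed.

Lemma spectral_limit :
  (\big[Num.max/0]_(i < n) (modulus (l i) / n%:R)) @[n --> \oo] --> mu.
Proof.
apply/cvgrPdist_le => eta eta_gt0.
pose M n := \big[Num.max/0]_(i < n) (modulus (l i) / n%:R).
have M_ge : \forall n \near \oo, mu - eta <= M n.
  have [h|h] := leP (mu - eta) 0.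
    by near=> n; rewrite (le_trans h)// bigmax_ge_id.
  have : mu - eta < mu by rewrite ltrBlDr ltrDl.
  move=> /(spectral_lower h); apply: filterS => n [i li].
  by rewrite (le_trans (ltW li))// (le_bigmax _ (fun i => modulus (l i) / n%:R)).
near=> n; have max_ge : mu - eta <= M n by near: n.
have max_le : M n <= mu + eta.
  apply: bigmax_le => [|i _]; first by rewrite addr_ge0 ?modulus_ge0// ltW.
  by apply/ltW; move: i; near: n; exact: spectral_upper.
rewrite -/(M n).
by rewrite ler_distlC lerBlDr max_le andbT; lra.
Unshelve. all: by end_near. Qed.

End spectral_limit.

(** * Integration on the cube *)

(** Change of variables towards a measure that is only known to agree with the
    image measure on measurable sets.  The measure structure of the image is
    named in the proof because it depends on mphi, which unification does not
    find. *)
Lemma ge0_integral_image d1 d2 (X : measurableType d1) (Y : measurableType d2)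
    (R : realType) (phi : X -> Y) (mphi : measurable_fun setT phi)
    (mu : {measure set X -> \bar R}) (nu : {measure set Y -> \bar R})
    (f : Y -> \bar R) :
  (forall A, measurable A -> nu A = mu (phi @^-1` A)) ->
  measurable_fun setT f -> (forall y, 0 <= f y)%E ->
  (\int[nu]_y f y = \int[mu]_x f (phi x))%E.
Proof.
move=> nuE mf f0.
have <- := @ge0_integral_pushforward _ _ _ _ R _ mphi mu setT f measurableT mf
  (fun y _ => f0 y).
apply: (@eq_measure_integral _ _ _ _
  (measure_function_pushforward__canonical__measure_function_Measure mu mphi)).
by move=> A mA _; exact: nuE.
Qed.

Section lebesgue_translation.
Context {R : realType}.
Local Open Scope ereal_scope.

Let shift_measurable (y : R) :
  measurable_fun setT (fun a : measurableTypeR R => (a - y)%R : measurableTypeR R).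
Proof. by apply: measurable_funB => //; exact: measurable_id. Qed.

(** Uniqueness: both measures agree on half-open intervals. *)
Lemma lebesgue_measure_shift (y : R) (A : set (measurableTypeR R)) :
  measurable A ->
  pushforward lebesgue_measure
    (fun a : measurableTypeR R => (a - y)%R : measurableTypeR R) A =
  lebesgue_measure A.
Proof.
move=> mA; apply/esym.
apply: (@lebesgue_measure_unique R (pushforward lebesgue_measure
    (fun a : measurableTypeR R => (a - y)%R : measurableTypeR R))) => // X.
move=> [[a b] _ <-]; rewrite /pushforward.
rewrite [X in _ = lebesgue_measure X](_ : _ = `](a + y)%R, (b + y)%R]%classic); last first.
  by apply/seteqP; split=> x /=; rewrite !in_itv/= ltrBrDr lerBlDr.
by rewrite !lebesgue_measure_itv/= !lte_fin ltrD2r -!EFinB [(a + y)%R]addrC addrKA.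
Qed.

Lemma integral_shift (y : R) (h : measurableTypeR R -> \bar R) :
  measurable_fun setT h -> (forall a, 0 <= h a) ->
  \int[lebesgue_measure]_a h (a - y)%R = \int[lebesgue_measure]_a h a.
Proof.
move=> mh h0.
apply/esym/(ge0_integral_image (shift_measurable y)) => // A mA.
exact/esym/lebesgue_measure_shift.
Qed.

End lebesgue_translation.

Section lebesgue_tuple_integral.
Context {R : realType}.
Local Open Scope ereal_scope.

Definition cons_point n (z : measurableTypeR R * Rd R n) : Rd R n.+1 :=
  [tuple of z.1 :: z.2].

Lemma measurable_cons_point n : measurable_fun setT (@cons_point n).
Proof. exact: measurable_cons. Qed.

Lemma integral_lebesgue_tupleS n (f : Rd R n.+1 -> \bar R) :
  measurable_fun setT f -> (forall x, 0 <= f x) ->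
  \int[lebesgue_tuple n.+1]_x f x =
  \int[lebesgue_measure]_a \int[lebesgue_tuple n]_v f (cons_point (a, v)).
Proof.
move=> mf f0.
rewrite (ge0_integral_image (@measurable_cons_point n)
  (mu := (lebesgue_measure \x lebesgue_tuple n)))//.
rewrite fubini_tonelli1//.
exact: measurableT_comp mf (@measurable_cons_point _).
Qed.

Lemma measurable_section_integral n (f : Rd R n.+1 -> \bar R) :
  measurable_fun setT f -> (forall x, 0 <= f x) ->
  measurable_fun setT
    (fun a : measurableTypeR R => \int[lebesgue_tuple n]_v f (cons_point (a, v))).
Proof.
move=> mf f0.
apply: (@measurable_fun_fubini_tonelli_F _ _ _ _ _ (lebesgue_tuple n)
  (f \o @cons_point n)) => [|z]; last exact: f0.
exact: measurableT_comp mf (@measurable_cons_point _).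
Qed.

Lemma measurable_vsub d :
  measurable_fun setT (fun z : Rd R d * Rd R d => vsub z.1 z.2).
Proof.
apply/measurable_fun_tnthP => i.
rewrite (_ : _ \o _ = (fun z : Rd R d * Rd R d => (tnth z.1 i - tnth z.2 i)%R)); last first.
  by apply/funext => z /=; rewrite tnth_mktuple.
apply: measurable_funB.
  exact: (measurableT_comp (measurable_tnth i) measurable_fst).
exact: (measurableT_comp (measurable_tnth i) measurable_snd).
Qed.

Lemma measurable_vsubl d (y : Rd R d) : measurable_fun setT (fun x => vsub x y).
Proof.
exact: (measurableT_comp (@measurable_vsub d) (pair2_measurable y)).
Qed.

Lemma vsub_cons n (a : R) (v : Rd R n) (y : Rd R n.+1) :
  vsub (cons_point (a, v)) y =
  cons_point ((a - thead y)%R : measurableTypeR R, vsub v [tuple of behead y]).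
Proof.
apply: eq_from_tnth => i; rewrite tnth_mktuple.
have [j ->|->] := unliftP ord0 i; last by rewrite !tnth0 /thead.
rewrite !tnthS tnth_mktuple tnth_behead; congr (_ - tnth y _)%R.
by apply: val_inj; rewrite /= inordK ?ltnS//.
Qed.

(** Translation invariance, one coordinate at a time. *)
Lemma integral_vsub d (y : Rd R d) (f : Rd R d -> \bar R) :
  measurable_fun setT f -> (forall x, 0 <= f x) ->
  \int[lebesgue_tuple d]_x f (vsub x y) = \int[lebesgue_tuple d]_x f x.
Proof.
elim: d y f => [|d IH] y f mf f0.
  by apply: eq_integral => x _; congr f; apply: eq_from_tnth => -[].
rewrite integral_lebesgue_tupleS//; last first.
  exact: (measurableT_comp mf (measurable_vsubl y)).
rewrite [RHS]integral_lebesgue_tupleS//.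
rewrite -[RHS](integral_shift (thead y)); last 2 first.
- exact: measurable_section_integral.
- by move=> a; exact: integral_ge0.
apply: eq_integral => a _.
under eq_integral do rewrite vsub_cons.
rewrite (IH _ (fun v => f (cons_point ((a - thead y)%R : measurableTypeR R, v))))//.
exact: (measurableT_comp mf (measurableT_comp (@measurable_cons_point _) (pair1_measurable _))).
Qed.

Lemma measurable_cube d : measurable (@cube R d).
Proof.
have -> : @cube R d =
    \bigcap_(i in [set: 'I_d]) (fun x : Rd R d => tnth x i) @^-1` `[(- 2^-1)%R, (2^-1)%R]%classic.
  apply/seteqP; split=> x h i; last by have := h i Logic.I; rewrite /= in_itv.
  by move=> _; rewrite /= in_itv; exact: h.
apply: fin_bigcap_measurable; first exact: finite_finset.
move=> i _; by rewrite -[X in measurable X]setTI; exact: measurable_tnth.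
Qed.

Lemma cube_cons n (a : R) (v : Rd R n) :
  cube (cons_point (a, v)) <-> (- 2^-1 <= a <= 2^-1)%R /\ cube v.
Proof.
split=> [h|[ha hv] i].
  split=> [|i]; first by have := h ord0; rewrite tnth0.
  by have := h (lift ord0 i); rewrite tnthS.
by have [j ->|->] := unliftP ord0 i; rewrite ?tnthS ?tnth0.
Qed.

Lemma integral_cubeS n (f : Rd R n.+1 -> \bar R) :
  measurable_fun setT f -> (forall x, 0 <= f x) ->
  \int[lebesgue_tuple n.+1]_(x in cube) f x =
  \int[lebesgue_measure]_(a in `[(- 2^-1)%R, (2^-1)%R]%classic)
    \int[lebesgue_tuple n]_(v in cube) f (cons_point (a, v)).
Proof.
move=> mf f0; rewrite integral_mkcond integral_lebesgue_tupleS; first last.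
- by move=> x; exact: erestrict_ge0.
- apply: (measurable_restrictT _ (@measurable_cube _)).1.
  exact: measurable_funTS.
rewrite [RHS]integral_mkcond; apply: eq_integral => a _.
rewrite patchE; case: ifPn => [|]; rewrite !(inE, notin_setE)/= in_itv/= => ha.
  rewrite [RHS]integral_mkcond; apply: eq_integral => v _; rewrite !patchE.
  by congr (if _ then _ else _); apply/asboolP/asboolP; rewrite cube_cons; tauto.
apply: integral0_eq => v _; rewrite patchE ifF//.
by apply/negbTE; rewrite notin_setE cube_cons => -[].
Qed.

End lebesgue_tuple_integral.

(** * Orthogonality of the characters of the cube *)

Section fourier_orthogonality.
Context {R : realType}.

Lemma sin_pi_int (k : int) : sin (pi * k%:~R) = 0 :> R.
Proof.
have sin_nat n : sin (pi * n%:R) = 0 :> R.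
  elim: n => [|n IH]; first by rewrite mulr0 sin0.
  by rewrite -natr1 mulrDr mulr1 sinDpi IH oppr0.
case: k => n; first exact: sin_nat.
by rewrite NegzE mulrNz mulrN sinN sin_nat oppr0.
Qed.

(** Adding 1 to the cosine makes the integrand nonnegative, so that Tonelli's
    theorem applies in higher dimension; the boolean b records whether the
    other coordinates of the frequency vanish. *)
Lemma integral_itv_cos (k : int) (b : bool) (t : R) :
  (\int[lebesgue_measure]_(a in `[(- 2^-1)%R, (2^-1)%R]%classic)
     (1 + b%:R * cos (t - 2 * pi * (k%:~R * a)))%:E =
   (1 + (b && (k == 0))%:R * cos t)%:E)%E.
Proof.
have half : - 2^-1 < 2^-1 :> R by rewrite (@lt_trans _ _ 0)// oppr_lt0.
have [k0|k0] := eqVneq k 0; last case: b; last first.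
- rewrite /= mul0r addr0; under eq_integral do rewrite mul0r addr0.
  rewrite integral_cst//= lebesgue_measure_itv/= lte_fin half -EFinB mul1e.
  by congr EFin; lra.
- rewrite /= mul0r addr0; under eq_integral do rewrite mul1r.
  pose K : R := 2 * pi * k%:~R.
  have K0 : K != 0.
    by rewrite mulf_neq0 ?intr_eq0// mulf_neq0 ?pnatr_eq0// gt_eqF// pi_gt0.
  pose G (a : R) := a - K^-1 * sin (t - K * a).
  have dG (a : R) : is_derive a 1 G (1 + cos (t - 2 * pi * (k%:~R * a))).
    rewrite /G; apply: is_derive_eq.
    have -> : 2 * pi * (k%:~R * a) = K * a by rewrite mulrA.
    rewrite !scaler1 /GRing.scale /=; clearbody K.
    by field.
  have cont_G : continuous G.
    by move=> a; apply/differentiable_continuous/derivable1_diffP; apply: ex_derive.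
  rewrite (@continuous_FTC2 R _ G _ _ half).
  + rewrite -EFinB /G; congr EFin.
    have -> : K * 2^-1 = pi * k%:~R by rewrite /K; field.
    have -> : K * - 2^-1 = - (pi * k%:~R) by rewrite /K; field.
    rewrite sinB opprK sinD sin_pi_int.
    by field.
  + apply: continuous_subspaceT => a.
    apply: continuousD; first exact: cst_continuous.
    apply: continuous_comp; last exact: continuous_cos.
    apply: continuousB; first exact: cst_continuous.
    by do 2 apply: continuousM => //; exact: cst_continuous.
  + split=> [a _||]; first exact: ex_derive.
    * exact/cvg_at_right_filter/cont_G.
    * exact/cvg_at_left_filter/cont_G.
  + by move=> a _; rewrite derive1E; exact: derive_val.
- rewrite k0 andbT.
  under eq_integral do rewrite mulr0z mul0r mulr0 subr0.
  rewrite integral_cst//= lebesgue_measure_itv/= lte_fin half -EFinB -EFinM.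
  by congr EFin; lra.
Qed.

Definition zvanish d (m : d.-tuple int) : bool := all (pred1 0) m.

Lemma dotZ_cons d (m : d.+1.-tuple int) (a : R) (v : Rd R d) :
  dotZ m (cons_point (a, v)) =
  (thead m)%:~R * a + dotZ [tuple of behead m] v.
Proof.
rewrite /dotZ big_ord_recl tnth0 /thead; congr (_ + _).
apply: eq_bigr => i _; rewrite tnthS tnth_behead; congr ((tnth m _)%:~R * _).
by apply: val_inj; rewrite /= inordK ?ltnS.
Qed.

Lemma measurable_dotZ d (m : d.-tuple int) : measurable_fun setT (@dotZ R d m).
Proof.
apply: measurable_sum => i; apply: measurable_funM; first exact: measurable_cst.
exact: measurable_tnth.
Qed.

Lemma measurable_cos_dotZ d (m : d.-tuple int) (t : R) :
  measurable_fun setT (fun x : Rd R d => (1 + cos (2 * pi * dotZ m x - t))%:E).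
Proof.
apply/measurable_EFinP; apply: measurable_funD; first exact: measurable_cst.
apply: (measurableT_comp (continuous_measurable_fun (@continuous_cos R))).
apply: measurable_funB; last exact: measurable_cst.
apply: measurable_funM; [exact: measurable_cst|exact: measurable_dotZ].
Qed.

Lemma cos1_ge0 (t : R) : 0 <= 1 + cos t.
Proof. by rewrite addrC -lerBlDr sub0r cos_geN1. Qed.

(** Integrating out the last coordinates turns the first one into a phase
    shift, which is why t is arbitrary in the induction. *)
Lemma integral_cube_cos d (m : d.-tuple int) (t : R) :
  (\int[lebesgue_tuple d]_(x in cube) (1 + cos (2 * pi * dotZ m x - t))%:E =
   (1 + (zvanish m)%:R * cos t)%:E)%E.
Proof.
elim: d m t => [|d IH] m t.
  rewrite /= (_ : cube = setT); last by apply/seteqP; split=> // x _ [].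
  rewrite integral_dirac//; last exact: measurable_cos_dotZ.
  rewrite diracE mem_set// mul1e /dotZ big_ord0 mulr0 sub0r cosN.
  by rewrite /zvanish tuple0 /= mul1r.
rewrite integral_cubeS; first last.
- by move=> x; rewrite lee_fin cos1_ge0.
- exact: measurable_cos_dotZ.
transitivity (\int[lebesgue_measure]_(a in `[(- 2^-1)%R, (2^-1)%R]%classic)
  (1 + (zvanish [tuple of behead m])%:R * cos (t - 2 * pi * ((thead m)%:~R * a)))%:E)%E.
  apply: eq_integral => a _; rewrite -IH; apply: eq_integral => v _.
  by rewrite dotZ_cons; congr ((1 + cos _)%:E); ring.
rewrite integral_itv_cos; congr ((1 + _%:R * _)%:E).
by rewrite [in RHS](tuple_eta m) /zvanish /= andbC.
Qed.

End fourier_orthogonality.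

(** * Exponential sums *)

Section exponential_sums.
Context {R : realType}.

Lemma modulus_cexpi (a : R) : modulus (cexpi a) = 1.
Proof. by rewrite /modulus /cexpi /= cos2Dsin2 sqrtr1. Qed.

Lemma cexpiB (a b : R) : cexpi (a - b) = cexpi a * (cexpi b)^*%C.
Proof.
rewrite /cexpi cosB sinB; apply/eqP; rewrite eq_complex /=; apply/andP; split; apply/eqP; ring.
Qed.

Lemma sqr_modulus_cexpi_sum n (a : 'I_n -> R) :
  modulus (\sum_i cexpi (a i)) ^+ 2 = \sum_(p : 'I_n * 'I_n) cos (a p.1 - a p.2).
Proof.
rewrite /modulus /ComplexField.Normc.normc.
case E : (\sum_i _) => [u v].
have -> : u = \sum_i cos (a i).
  by rewrite -[u]/(complex.Re (u +i* v)) -E (raddf_sum (@complex.Re R)).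
have -> : v = \sum_i sin (a i).
  by rewrite -[v]/(complex.Im (u +i* v)) -E (raddf_sum (@complex.Im R)).
rewrite sqr_sqrtr ?addr_ge0 ?sqr_ge0//.
rewrite -(pair_bigA _ (fun i j => cos (a i - a j)))/= !expr2 !mulr_suml -big_split/=.
apply: eq_bigr => i _; rewrite !mulr_sumr -big_split/=.
by apply: eq_bigr => j _; rewrite cosB.
Qed.

(** Between two consecutive squares a sum of n unimodular terms moves by at
    most the distance between these squares, which is negligible before n. *)
Lemma mean_cvg_of_squares (z : nat -> R[i]) : (forall i, modulus (z i) = 1) ->
  modulus (\sum_(i < k.+1 ^ 2) z i) ^+ 2 / (k.+1)%:R ^+ 4 @[k --> \oo] --> 0 ->
  modulus (n%:R^-1 * \sum_(i < n) z i) @[n --> \oo] --> 0.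
Proof.
move=> z1 sq; apply/cvgrPdist_le => e e_gt0.
pose S n := modulus (\sum_(i < n) z i).
have e2 : 0 < (e / 2) ^+ 2 by rewrite exprn_gt0// divr_gt0.
have /cvgrPdist_le/(_ _ e2) := sq.
move=> [k1 _ sqk1].
pose k2 := (Num.truncn (4 / e)).+1.
exists ((maxn k1 k2).+1 ^ 2)%N => // n /= kn.
have [k [kk kn1 kn2]] : exists k, [/\ (maxn k1 k2 <= k)%N,
    (k.+1 ^ 2 <= n)%N & (n < k.+2 ^ 2)%N].
  have ex : exists k, (n < k.+2 ^ 2)%N.
    by exists n; rewrite (@leq_trans n.+2)// -mulnn leq_pmulr.
  case: (ex_minnP ex) => k knk kmin; exists k; split=> //.
    rewrite leqNgt; apply/negP => lt.
    move: kn; rewrite leqNgt (leq_trans knk)//.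
    by rewrite leq_exp2r.
  case: k knk kmin => [|k] knk kmin; first by rewrite (leq_trans _ kn)// expn_gt0.
  by rewrite leqNgt; apply/negP => /kmin; rewrite ltnn.
have n_gt0 : 0 < n%:R :> R by rewrite ltr0n (leq_trans _ kn1)// expn_gt0.
have Sk : S (k.+1 ^ 2)%N <= e / 2 * k.+1%:R ^+ 2.
  have := sqk1 k; rewrite /= (leq_trans (leq_maxl _ _) kk) => /(_ isT).
  rewrite sub0r normrN ger0_norm; last by rewrite divr_ge0 ?exprn_ge0 ?modulus_ge0.
  rewrite ler_pdivrMr ?exprn_gt0// (exprM _ 2 2) -exprMn.
  by rewrite ler_pXn2r// nnegrE ?modulus_ge0// mulr_ge0 ?exprn_ge0// ltW// divr_gt0.
have Sn : S n <= S (k.+1 ^ 2)%N + 2 * k.+1%:R.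
  rewrite /S -!(big_mkord xpredT z) (big_cat_nat (n := (k.+1 ^ 2)%N))//=.
  rewrite (le_trans (ler_modulusD _ _))// lerD2l (le_trans (ler_modulus_sum _ _ _))//.
  under eq_bigr do rewrite z1.
  rewrite sumr_const_nat -natrM ler_nat leq_subLR.
  by move: kn2; clear; rewrite -!mulnn; nia.
have kR : 4 / e <= k.+1%:R.
  rewrite (le_trans (ltW (truncnS_gt _)))// ler_nat.
  by rewrite (leq_trans _ (leqnSn k))// (leq_trans (leq_maxr k1 _) kk).
rewrite sub0r normrN ger0_norm ?modulus_ge0// modulusM modulusV modulus_nat.
rewrite ler_pdivrMl//.
have kn' : k.+1%:R ^+ 2 <= n%:R :> R by rewrite -natrX ler_nat.
rewrite ler_pdivrMr// in kR.
have k_gt0 : 0 < k.+1%:R :> R by [].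
apply: le_trans Sn _; rewrite -/(S _).
move: Sk kR kn' k_gt0; set K := k.+1%:R; set s := S _; set N := n%:R => Sk kR kn' k_gt0.
have h1 : 4 * K <= K * e * K by rewrite ler_pM2r.
have h2 : e * K ^+ 2 <= e * N by rewrite ler_pM2l.
by rewrite mulrC; lra.
Qed.

End exponential_sums.

(** * Independent uniform points of the cube *)

Section uniform_points.
Context {R : realType} {d : nat} {dT : measure_display} {T : measurableType dT}.
Context {P : probability T R}.
Variable X : nat -> {RV P >-> Rd R d}.
Hypothesis X_indep : mutually_independent X.
Hypothesis X_unif : forall i, uniform_on_cube (X i).
Local Open Scope ereal_scope.

Local Notation L := (@lebesgue_tuple R d).

Lemma lebesgue_cube : L cube = 1.
Proof.
have := X_unif 0%N measurableT; rewrite setTI => <-.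
by rewrite /distribution /pushforward preimage_setT probability_setT.
Qed.

Lemma integral_uniform i (g : Rd R d -> \bar R) :
  measurable_fun setT g -> (forall x, 0 <= g x) ->
  \int[distribution P (X i)]_x g x = \int[L]_(x in cube) g x.
Proof.
move=> mg g0; have mcube := @measurable_cube R d.
rewrite (@ge0_negligible_integral _ _ _ (distribution P (X i)) setT (~` cube))//.
- rewrite setDE setCK setTI; apply: eq_measure_integral => A mA Acube.
  by apply: etrans (X_unif i mA) _; rewrite setIidl.
- exact: measurableC.
- apply: etrans (X_unif i (measurableC mcube)) _.
  by rewrite setICl measure0.
Qed.

Lemma pairwise_independent i j (A B : set (Rd R d)) : i != j ->
  measurable A -> measurable B ->
  P ((X i @^-1` A) `&` (X j @^-1` B)) =
  distribution P (X i) A * distribution P (X j) B.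
Proof.
move=> ij mA mB; pose Bs k := if k == i then A else B.
have mBs k : measurable (Bs k) by rewrite /Bs; case: ifP.
have := X_indep [fset i; j]%fset mBs.
rewrite big_fsetU1 ?inE//= big_seq_fset1 /Bs eqxx eq_sym (negPf ij).
rewrite /distribution /pushforward => <-; congr (P _).
apply/seteqP; split=> [w [wA wB] k|w h].
  by rewrite /= !inE => /orP[]/eqP ->; rewrite ?eqxx// eq_sym (negPf ij).
split.
  by have := h i; rewrite /= !inE !eqxx; apply.
by have := h j; rewrite /= !inE !eqxx orbT eq_sym (negPf ij); apply.
Qed.

Let pairX i j w := (X i w, X j w).

Let measurable_pairX i j : measurable_fun setT (pairX i j).
Proof. by apply/measurable_fun_pairP; split; exact: measurable_funP. Qed.

(** By independence the joint law is the product of two uniform laws; the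
    uniform law is Lebesgue measure on the cube. *)
Lemma integral_pair i j (f : Rd R d * Rd R d -> \bar R) : i != j ->
  measurable_fun setT f -> (forall z, 0 <= f z) ->
  \int[P]_w f (X i w, X j w) =
  \int[L]_(y in cube) \int[L]_(x in cube) f (x, y).
Proof.
move=> ij mf f0.
have <- := @ge0_integral_image _ _ _ _ R _ (measurable_pairX i j) P
  (distribution P (X i) \x distribution P (X j)) f _ mf f0; last first.
  move=> A mA.
  apply: (@product_measure_unique _ _ _ _ _ _ _
    (measure_function_pushforward__canonical__measure_function_Measure P
      (measurable_pairX i j))) => // B C mB mC.
  rewrite -pairwise_independent//.
rewrite fubini_tonelli2// integral_uniform.
- apply: eq_integral => y _; rewrite /fubini_G integral_uniform//.
  exact: measurableT_comp mf (pair2_measurable _).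
- exact: measurable_fun_fubini_tonelli_G.
- by move=> y; exact: integral_ge0.
Qed.

(** The difference of two distinct points has an absolutely continuous law. *)
Lemma ae_difference (Q : Rd R d -> Prop) i j : i != j ->
  {ae L, forall x, Q x} -> {ae P, forall w, Q (vsub (X i w) (X j w))}.
Proof.
move=> ij [N [mN LN0 QN]].
exists [set w | N (vsub (X i w) (X j w))]; split.
- rewrite -[X in measurable X]setTI.
  exact: (measurableT_comp (@measurable_vsub R d) (measurable_pairX i j)).
- have mI : measurable_fun setT (fun z : Rd R d * Rd R d => (\1_N (vsub z.1 z.2))%:E : \bar R).
    apply/measurable_EFinP.
    exact: (measurableT_comp (measurable_indic mN) (@measurable_vsub R d)).
  transitivity (\int[P]_w (\1_N (vsub (X i w) (X j w)))%:E).
    rewrite (_ : (fun w => _) = EFin \o \1_[set w | N (vsub (X i w) (X j w))])//.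
    rewrite integral_indic ?setIT//.
    rewrite -[X in measurable X]setTI.
    exact: (measurableT_comp (@measurable_vsub R d) (measurable_pairX i j)).
  rewrite (@integral_pair i j (fun z => (\1_N (vsub z.1 z.2))%:E))//=.
  apply: integral0_eq => y _; apply/eqP; rewrite eq_le integral_ge0// andbT.
  have -> : 0 = \int[L]_x (\1_N x)%:E by rewrite integral_indic// setIT; exact/esym/LN0.
  rewrite -(integral_vsub y (f := fun x => (\1_N x)%:E))//; last first.
    exact/measurable_EFinP/measurable_indic.
  apply: ge0_subset_integral => //; first exact: measurable_cube.
  exact: measurableT_comp mI (pair2_measurable _).
- by move=> w /=; apply: contra_notP => /= nN; apply: contrapT => /QN.
Qed.

Section nonzero_frequency.
Variable m : d.-tuple int.
Hypothesis m_neq0 : ~~ zvanish m.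
Local Open Scope ring_scope.

Let phase i w : R := 2 * pi * dotZ m (X i w).

Let expsum n w : R[i] := \sum_(i < n) cexpi (phase i w).

Let measurable_phase i : measurable_fun setT (phase i).
Proof.
apply: measurable_funM; first exact: measurable_cst.
exact: (measurableT_comp (@measurable_dotZ R d m) (measurable_funP (X i))).
Qed.

Let measurable_cos_phase i j :
  measurable_fun setT (fun w => cos (phase i w - phase j w)).
Proof.
apply: (measurableT_comp (continuous_measurable_fun (@continuous_cos R))).
by apply: measurable_funB; exact: measurable_phase.
Qed.

Let expsumE n w : modulus (expsum n w) ^+ 2 =
  \sum_(p : 'I_n * 'I_n) cos (phase p.1 w - phase p.2 w).
Proof. exact: (sqr_modulus_cexpi_sum (fun i : 'I_n => phase i w)). Qed.

Let measurable_expsum n : measurable_fun setT (fun w => modulus (expsum n w) ^+ 2).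
Proof.
under eq_fun do rewrite expsumE.
by apply: measurable_sum => p; exact: measurable_cos_phase.
Qed.

Let integral_cos_phase i j :
  (\int[P]_w (1 + cos (phase i w - phase j w))%:E = (1 + (i == j)%:R)%:E)%E.
Proof.
have [->|ij] := eqVneq i j.
  under eq_integral do rewrite subrr cos0.
  by rewrite integral_cst//= probability_setT mule1.
pose f (z : Rd R d * Rd R d) : \bar R :=
  (1 + cos (2 * pi * dotZ m z.1 - 2 * pi * dotZ m z.2))%:E.
have f_ge0 z : (0 <= f z)%E by rewrite lee_fin cos1_ge0.
have mf : measurable_fun setT f.
  apply/measurable_EFinP; apply: measurable_funD; first exact: measurable_cst.
  apply: (measurableT_comp (continuous_measurable_fun (@continuous_cos R))).
  apply: measurable_funB; apply: measurable_funM; try exact: measurable_cst.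
    exact: (measurableT_comp (@measurable_dotZ R d m) measurable_fst).
  exact: (measurableT_comp (@measurable_dotZ R d m) measurable_snd).
rewrite (integral_pair ij mf f_ge0).
rewrite addr0; transitivity (\int[L]_(y in cube) (1%:E : \bar R))%E.
  apply: eq_integral => y _; apply: etrans (integral_cube_cos m (2 * pi * dotZ m y)) _.
  by rewrite (negPf m_neq0) mul0r addr0.
by rewrite integral_cst ?mul1e; [exact: lebesgue_cube|exact: measurable_cube].
Qed.

(** The squared modulus is the sum of the cosines of the phase differences: the
    diagonal contributes n and the other terms integrate to zero.  The constant
    n * n makes every summand nonnegative and is subtracted at the end. *)
Let second_moment n :
  (\int[P]_w (modulus (expsum n w) ^+ 2)%:E = n%:R%:E)%E.
Proof.
have total : (\int[P]_w (\sum_(p : 'I_n * 'I_n) (1 + cos (phase p.1 w - phase p.2 w))%:E) =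
    ((n * n)%:R + n%:R)%:E)%E.
  have f_ge0 (p : 'I_n * 'I_n) w : setT w -> (0 <= (1 + cos (phase p.1 w - phase p.2 w))%:E)%E.
    by rewrite lee_fin cos1_ge0.
  have mf (p : 'I_n * 'I_n) : measurable_fun setT
      (fun w => (1 + cos (phase p.1 w - phase p.2 w))%:E).
    by apply/measurable_EFinP; apply: measurable_funD.
  rewrite (ge0_integral_sum _ measurableT mf f_ge0).
  under eq_bigr do rewrite integral_cos_phase.
  rewrite sumEFin big_split/= sumr_const card_prod card_ord; congr (_ + _)%:E.
  rewrite -(pair_bigA _ (fun i j : 'I_n => (val i == val j)%:R))/=.
  rewrite (eq_bigr (fun=> 1%R)) ?sumr_const ?card_ord// => i _.
  rewrite (bigD1 i)//= eqxx big1 ?addr0// => j ji.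
  by rewrite eq_sym (inj_eq val_inj) (negPf ji).
have split_sum w : (\sum_(p : 'I_n * 'I_n) (1 + cos (phase p.1 w - phase p.2 w))%:E =
    (n * n)%:R%:E + (modulus (expsum n w) ^+ 2)%:E)%E.
  rewrite sumEFin big_split/= sumr_const card_prod card_ord EFinD.
  by rewrite expsumE.
move: total; under eq_integral do rewrite split_sum.
rewrite ge0_integralD//; last exact/measurable_EFinP; last first.
  by move=> w _; rewrite lee_fin sqr_ge0.
rewrite integral_cst//= probability_setT mule1.
case: (\int[P]_w _)%E => [r||]//= [] /addrI ->//.
Qed.

(** The second moments of the normalized sums are 1/n, which is summable along
    the squares: there the normalized sums tend to zero almost surely. *)
Lemma ae_mean_cexpi_cvg0 : {ae P, forall w,
  (modulus (n%:R^-1 * \sum_(i < n) cexpi (2 * pi * dotZ m (X i w))) @[n --> \oo]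
     --> 0)%R}.
Proof.
pose V k w : R := (modulus (expsum (k.+1 ^ 2) w) ^+ 2 / (k.+1)%:R ^+ 4)%R.
have V_ge0 k w : (0 <= V k w)%R.
  by rewrite /V divr_ge0 ?exprn_ge0 ?modulus_ge0.
have mV k : measurable_fun setT (fun w => (V k w)%:E).
  apply/measurable_EFinP; apply: measurable_funM; last exact: measurable_cst.
  exact: measurable_expsum.
have intV k : (\int[P]_w (V k w)%:E = ((k.+1)%:R ^- 2)%:E)%E.
  rewrite /V; under eq_integral do rewrite mulrC EFinM.
  rewrite ge0_integralZl_EFin//; first last.
  - exact/measurable_EFinP/measurable_expsum.
  - by move=> w _; rewrite lee_fin exprn_ge0 ?modulus_ge0.
  rewrite second_moment -EFinM; congr EFin.
  by rewrite natrX; field.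
have sumV : (\int[P]_w (\sum_(k <oo) (V k w)%:E) <= 2%:E)%E.
  rewrite integral_nneseries//; last by move=> k w _; rewrite lee_fin.
  under eq_eseriesr do rewrite intV.
  apply: lime_le; first by apply: is_cvg_nneseries => k _ _; rewrite lee_fin invr_ge0 exprn_ge0.
  apply: nearW => n; rewrite sumEFin lee_fin.
  (* Telescoping bound 1/K^2 <= 2/K - 2/(K+1). *)
  apply: (@le_trans _ _ (2 - 2 * (n.+1)%:R^-1)); last by rewrite gerBl mulr_ge0.
  elim: n => [|n IH]; first by rewrite big_geq// invr1; lra.
  rewrite big_nat_recr//= (le_trans (lerD IH (lexx _)))//.
  rewrite -[n.+2%:R]natr1; set K := n.+1%:R.
  have K1 : 1 <= K by rewrite /K ler1n.
  have K0 : 0 < K by rewrite (lt_le_trans _ K1).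
  have : 0 <= (K - 1) / (K ^+ 2 * (K + 1)).
    by rewrite divr_ge0 ?subr_ge0// mulr_ge0 ?exprn_ge0// ?addr_ge0// ltW.
  have -> : (K - 1) / (K ^+ 2 * (K + 1)) = 2 * K^-1 - 2 * (K + 1)^-1 - K ^- 2.
    by field; rewrite ?lt0r_neq0// addr_gt0.
  by move: (K ^- 2) (2 / K) (2 / (K + 1)) => a b c; lra.
have mS : measurable_fun setT (fun w => \sum_(k <oo) (V k w)%:E)%E.
  by apply: ge0_emeasurable_sum => // k w _ _; rewrite lee_fin.
have S_ge0 w : (0 <= \sum_(k <oo) (V k w)%:E)%E.
  by apply: nneseries_ge0 => k _ _; rewrite lee_fin.
have intS : P.-integrable setT (fun w => \sum_(k <oo) (V k w)%:E)%E.
  apply/integrableP; split=> //.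
  under eq_integral do rewrite gee0_abs//.
  exact: le_lt_trans sumV (ltry _).
have := integrable_ae measurableT intS.
apply: filterS => w /(_ Logic.I) fin.
apply: (@mean_cvg_of_squares _ (fun i => cexpi (phase i w))).
  by move=> i; exact: modulus_cexpi.
apply: (@cvg_series_cvg_0 _ _ (V^~ w)).
apply: nondecreasing_is_cvgn.
  by apply/nondecreasing_seqP => n; rewrite /series/= big_nat_recr//= lerDl.
exists (fine (\sum_(k <oo) (V k w)%:E)%E) => _ [n _ <-].
rewrite -lee_fin fineK// /series/= -sumEFin.
by apply: nneseries_lim_ge => k _ _; rewrite lee_fin.
Qed.

End nonzero_frequency.

End uniform_points.

(** * Convergence of the largest normalized eigenvalue *)

Lemma dotZ_vsub (R : realType) d (k : d.-tuple int) (x y : Rd R d) :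
  dotZ k (vsub x y) = dotZ k x - dotZ k y.
Proof.
rewrite /dotZ -sumrB; apply: eq_bigr => i _.
by rewrite tnth_mktuple mulrBr.
Qed.

Lemma character_vsub (R : realType) d (k : d.-tuple int) (x y : Rd R d) :
  cexpi (2 * pi * dotZ k (vsub x y)) =
  cexpi (2 * pi * dotZ k x) * (cexpi (2 * pi * dotZ k y))^*%C.
Proof. by rewrite dotZ_vsub mulrBr cexpiB. Qed.

Lemma character_diff (R : realType) d (k l : d.-tuple int) (x : Rd R d) :
  cexpi (2 * pi * dotZ l x) * (cexpi (2 * pi * dotZ k x))^*%C =
  cexpi (2 * pi * dotZ [tuple tnth l i - tnth k i | i < d] x).
Proof.
rewrite -cexpiB -mulrBr; congr (cexpi (_ * _)).
rewrite /dotZ -sumrB; apply: eq_bigr => i _.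
by rewrite tnth_mktuple rmorphB/= mulrBl.
Qed.

Lemma zvanish_diff d (k l : d.-tuple int) : k != l ->
  ~~ zvanish [tuple tnth l i - tnth k i | i < d].
Proof.
apply: contra => /all_tnthP vanish; apply/eqP/eq_from_tnth => i.
by have := vanish i; rewrite tnth_mktuple /= subr_eq0 => /eqP ->.
Qed.

Lemma vsubxx (R : realType) d (x : Rd R d) : vsub x x = origin.
Proof. by apply: eq_from_tnth => i; rewrite !tnth_mktuple subrr. Qed.

Lemma ae_forall_countable d (T : measurableType d) (R : realType)
    (mu : {measure set T -> \bar R}) (I : countType) (Q : I -> T -> Prop) :
  (forall i, {ae mu, forall w, Q i w}) -> {ae mu, forall w, forall i, Q i w}.
Proof.
move=> aeQ; pose Q' n w := if choice.unpickle n is Some i then Q i w else True.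
have : {ae mu, forall w, forall n, Q' n w}.
  apply: ae_foralln => n; rewrite /Q'; case: choice.unpickle => [i|]; first exact: aeQ.
  exact: nearW.
apply: filterS => w Qw i.
by have := Qw (choice.pickle i); rewrite /Q' choice.pickleK.
Qed.

Unset Implicit Arguments.
Set Strict Implicit.

Theorem mainTheorem2 (R : realType) (d : nat) (hd : (1 <= d)%N)
  (F : Rd R d -> R[i])
  (F_meas : cmeasurable F)
  (F_int : cintegrable (lebesgue_tuple d) cube F)
  (F_per : periodic1 F)
  (F_series : {ae lebesgue_tuple d, forall x, has_sum
     (fun k : d.-tuple int => fourier_coef F k * cexpi (2 * pi * dotZ k x)) (F x)})
  (F_series0 : has_sum
     (fun k : d.-tuple int => fourier_coef F k * cexpi (2 * pi * dotZ k origin))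
     (F origin))
  (dT : measure_display) (T : measurableType dT) (P : probability T R)
  (X : nat -> {RV P >-> Rd R d})
  (X_indep : mutually_independent X)
  (X_unif : forall i, uniform_on_cube (X i))
  (lambda : forall n : nat, T -> 'I_n -> R[i])
  (lambda_eig : forall n w,
     eigenvalues_of (euclidean_matrix F (fun i => X i w) n) (lambda n w)) :
  exists k0 : d.-tuple int,
    (forall k : d.-tuple int,
       modulus (fourier_coef F k) <= modulus (fourier_coef F k0)) /\
    {ae P, forall w,
       (\big[Num.max/0]_(i < n) (modulus (lambda n w i) / n%:R)) @[n --> \oo]
         --> modulus (fourier_coef F k0)}.
Proof.
pose c := fourier_coef F.
pose e (x : Rd R d) (k : d.-tuple int) : R[i] := cexpi (2 * pi * dotZ k x).
(* At the origin all characters are 1: the coefficients are summable. *)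
have c_sum : has_sum c (F origin).
  rewrite (_ : c = fun k => c k * e origin k)//; apply/funext => k.
  rewrite /e /dotZ big1 ?mulr0; last by move=> i _; rewrite tnth_mktuple mulr0.
  by rewrite /cexpi cos0 sin0; exact/esym/mulr1.
have tails := has_sum_small_tail c_sum.
have [k0 k0_max] := exists_max_modulus [tuple 0 | i < d] tails.
exists k0; split; first exact: k0_max.
(* Diagonal entries use the series at the origin, the others its validity
   almost everywhere. *)
pose sum_at x := has_sum (fun k => c k * e x k) (F x).
have ae_sums : {ae P, forall w, forall p : nat * nat,
    sum_at (vsub (X p.1 w) (X p.2 w))}.
  apply: ae_forall_countable => -[i j] /=; have [->|ij] := eqVneq i j.
    by apply: nearW => w; rewrite vsubxx; exact: F_series0.
  exact: (ae_difference X_indep X_unif ij F_series).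
have ae_orth : {ae P, forall w, forall p : d.-tuple int * d.-tuple int,
    p.1 != p.2 -> modulus (n%:R^-1 * \sum_(i < n) e (X i w) p.2 * (e (X i w) p.1)^*%C)
      @[n --> \oo] --> 0}.
  apply: ae_forall_countable => -[k l] /=; have [->|kl] := eqVneq k l.
    by apply: nearW => w.
  have := ae_mean_cexpi_cvg0 X_indep X_unif (zvanish_diff kl).
  apply: filterS => w; rewrite /e => + _.
  apply: cvg_trans; apply: near_eq_cvg; apply: nearW => n.
  by congr (modulus (_ * _)); apply: eq_bigr => i _; rewrite character_diff.
move: ae_sums ae_orth; apply: filterS2 => w sums orth.
apply: (@spectral_limit R _ c (fun k i => e (X i w) k)
  (euclidean_matrix F (fun i => X i w)) (fun n => lambda n w) k0 tails k0_max).
- by move=> k i; exact: modulus_cexpi.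
- move=> n i j; rewrite mxE.
  have := sums (val i, val j); rewrite /sum_at /=.
  rewrite (_ : (fun k => _) = fun k => c k * (e (X i w) k * (e (X j w) k)^*%C))//.
  by apply/funext => k; rewrite /e character_vsub.
- by move=> k l kl; exact: (orth (k, l)).
- by move=> n; exact: lambda_eig.
Qed.
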